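(* Let $\boldsymbol X$ be a random element of $\mathcal H$ with $\mathbb E[\boldsymbol X]=0$ and $\boldsymbol Y$ a random vector in $\mathbb R^q$ with $\mathbb E[\|\boldsymbol X\|^2+\|\boldsymbol Y\|^2]<\infty$. Then: (i) $\mathrm{MDDO}(\boldsymbol X|\boldsymbol Y)=0$ if and only if $\mathbb E[\boldsymbol X|\boldsymbol Y]=0$ almost surely; (ii) for every bounded linear operator $T:\mathcal H\to\mathcal H$, $\mathrm{MDDO}(T^*\boldsymbol X|\boldsymbol Y)=T^*\,\mathrm{MDDO}(\boldsymbol X|\boldsymbol Y)\,T$, where $T^*$ is the adjoint of $T$.
   Context: $\mathcal H=L^2([0,1])$ with inner product $\langle f,g\rangle=\int_0^1 f g$ and norm $\|\cdot\|$. For $x,y\in\mathcal H$, $x\otimes y$ is the operator $z\mapsto\langle x,z\rangle y$. Martingale difference divergence operator: for $\boldsymbol s\in\mathbb R^q$ let $G_{\boldsymbol s}(t)=\mathrm{cov}(\boldsymbol X(t),e^{\mathrm i\langle \boldsymbol s,\boldsymbol Y\rangle})$ and $\mathrm{MDDO}(\boldsymbol X|\boldsymbol Y)=c_q^{-1}\int_{\mathbb R^q}\|\boldsymbol s\|^{-1-q}G_{\boldsymbol s}\otimes\overline{G_{\boldsymbol s}}\,d\boldsymbol s$ with $c_q=\pi^{(q+1)/2}/\Gamma((q+1)/2)$, integral in the principal value sense $\lim_{\varepsilon\to0^+}\int_{\varepsilon\le\|\boldsymbol s\|\le\varepsilon^{-1}}$. The same definition applies to any mean-zero random element (e.g. $T^*\boldsymbol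 X$) in place of $\boldsymbol X$. *)

(* Defs.v *)
From HB Require Import structures.
From mathcomp Require Import all_boot all_order all_algebra.
From mathcomp Require Import all_classical all_reals all_analysis.
Set Implicit Arguments.
Unset Strict Implicit.
Unset Printing Implicit Defensive.
Import Order.TTheory GRing.Theory Num.Theory.
Import numFieldNormedType.Exports.
Local Open Scope classical_set_scope.
Local Open Scope ring_scope.

Section MDDO.
Context {R : realType}.

Notation leb := (@lebesgue_measure R).

Definition I01 : set R := `[0%R, 1%R]%classic.

(** f represents an element of H = L^2([0,1]) *)
Definition L2 (f : R -> R) : Prop :=
  measurable_fun I01 f /\
  (\int[leb]_(t in I01) ((f t) ^+ 2)%:E < +oo)%E.

Definition ip (f g : R -> R) : R := Rintegral leb I01 (fun t => f t * g t).

Definition Heq (f g : R -> R) : Prop := {ae leb, forall t, I01 t -> f t = g t}.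

Definition eucl_dot (q : nat) (s y : q.-tuple R) : R :=
  \sum_(i < q) tnth s i * tnth y i.
Definition eucl_norm (q : nat) (s : q.-tuple R) : R :=
  Num.sqrt (\sum_(i < q) tnth s i ^+ 2).

(** Lebesgue integral over R^q, written as the iterated integral
    (equal to the q-dimensional Lebesgue integral for integrable
    integrands, by Fubini) *)
Fixpoint Riter (n : nat) : (n.-tuple R -> R) -> R :=
  match n with
  | 0 => fun F => F [tuple]
  | n'.+1 => fun F =>
      Rintegral leb setT (fun x : R => Riter (fun t => F (cons_tuple x t)))
  end.

Definition Gamma (x : R) : R :=
  Rintegral leb `]0%R, +oo[%classic (fun t => t `^ (x - 1) * expR (- t)).

Definition c_q (q : nat) : R :=
  pi `^ (q.+1%:R / 2) / Gamma (q.+1%:R / 2).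

Section Proba.
Context {d : measure_display} {Omega : measurableType d}
        (P : probability Omega R).

Definition Ex (Z : Omega -> R) : R := Rintegral P setT Z.

(** X : Omega -> H is a random element of H, represented by a jointly
    measurable version (omega, t) |-> X omega t *)
Definition random_element (X : Omega -> R -> R) : Prop :=
  measurable_fun [set: Omega * R] (fun p : Omega * R => X p.1 p.2).

Definition mean_zero (X : Omega -> R -> R) : Prop :=
  {ae leb, forall t, I01 t -> Ex (fun w => X w t) = 0}.

(** E[X | Y] = 0 a.s.: the zero random element satisfies the defining
    property of the conditional expectation, i.e. the (Bochner) integral
    of X over every event {Y \in B} vanishes in H. *)
Definition cond_exp_zero (q : nat) (X : Omega -> R -> R)
    (Y : Omega -> q.-tuple R) : Prop :=
  forall B : set (q.-tuple R), measurable B ->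
    {ae leb, forall t, I01 t ->
        Rintegral P (Y @^-1` B) (fun w => X w t) = 0}.

(** G_s(t) = cov(X(t), e^{i<s,Y>}) = Gre s t + i * Gim s t *)
Definition Gre (q : nat) (X : Omega -> R -> R) (Y : Omega -> q.-tuple R)
    (s : q.-tuple R) (t : R) : R :=
  Ex (fun w => X w t * cos (eucl_dot s (Y w)))
  - Ex (fun w => X w t) * Ex (fun w => cos (eucl_dot s (Y w))).
Definition Gim (q : nat) (X : Omega -> R -> R) (Y : Omega -> q.-tuple R)
    (s : q.-tuple R) (t : R) : R :=
  Ex (fun w => X w t * sin (eucl_dot s (Y w)))
  - Ex (fun w => X w t) * Ex (fun w => sin (eucl_dot s (Y w))).

(** <(G_s (x) conj G_s) f, g> = <G_s, f> * <conj G_s, g>,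
    real and imaginary parts *)
Definition rank1_re q X Y (f g : R -> R) (s : q.-tuple R) : R :=
  ip (Gre X Y s) f * ip (Gre X Y s) g + ip (Gim X Y s) f * ip (Gim X Y s) g.
Definition rank1_im q X Y (f g : R -> R) (s : q.-tuple R) : R :=
  ip (Gim X Y s) f * ip (Gre X Y s) g - ip (Gre X Y s) f * ip (Gim X Y s) g.

Definition pv_weighted_to (q : nat) (F : q.-tuple R -> R) (l : R) : Prop :=
  (fun eps : R => Riter (fun s : q.-tuple R =>
      (if (eps <= eucl_norm s) && (eucl_norm s <= eps^-1) then 1 else 0)
      * ((c_q q)^-1 * (eucl_norm s) ^- q.+1 * F s))) x @[x --> 0^'+] --> l.

(** <MDDO(X|Y) f, g> = lr + i li   (MDDO(X|Y) in the weak sense) *)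
Definition MDDO_form_to q X Y (f g : R -> R) (lr li : R) : Prop :=
  pv_weighted_to (@rank1_re q X Y f g) lr /\
  pv_weighted_to (@rank1_im q X Y f g) li.

Definition MDDO_zero q X Y : Prop :=
  forall f g, L2 f -> L2 g -> @MDDO_form_to q X Y f g 0 0.

End Proba.

Definition bounded_linear_op (T : (R -> R) -> (R -> R)) : Prop :=
  [/\ forall f, L2 f -> L2 (T f),
      forall f g, L2 f -> L2 g -> Heq f g -> Heq (T f) (T g),
      forall (a : R) f g, L2 f -> L2 g ->
        Heq (T (fun t => a * f t + g t)) (fun t => a * T f t + T g t)
    & exists C : R, forall f, L2 f -> ip (T f) (T f) <= C * ip f f].

Definition is_adjoint (T Ts : (R -> R) -> (R -> R)) : Prop :=
  bounded_linear_op Ts /\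
  forall f g, L2 f -> L2 g -> ip (Ts f) g = ip f (T g).

End MDDO.

(* Main.v *)
Require Import Defs.
From HB Require Import structures.
From mathcomp Require Import all_boot all_order all_algebra.
From mathcomp Require Import all_classical all_reals all_analysis.
From mathcomp Require Import measurable_realfun.
From mathcomp Require Import ring lra.
Import Order.TTheory GRing.Theory Num.Theory.
Import numFieldNormedType.Exports.
Local Open Scope classical_set_scope.
Local Open Scope ring_scope.

(** Write h_f(w) = <X(w), f>.  By Fubini <G_s, f> = E[h_f e^{i<s,Y>}], because
    E[h_f] = 0.  Part (ii) follows since <T^* X, f> = <X, T f> almost surely, so
    that the two integrands coincide for every s.  For (i), take f = g: the
    integrand is a positive weight times |<G_s, f>|^2, which is continuous in s,
    so a zero principal value forces E[h_f e^{i<s,Y>}] = 0 for every s.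
    Functions of Y orthogonal to h_f thus contain the algebra of trigonometric
    polynomials and are closed under bounded pointwise limits; iterating
    u |-> u (3 - u^2) / 2 on sin((Y_i - a) / m) gives the sign of Y_i - a in the
    limit, hence the indicators of orthants, hence by Dynkin's theorem all
    indicators 1_B(Y).  Testing against f = 1_E for all Borel sets E yields
    E[X(t) 1_B(Y)] = 0 for almost every t. *)

Set Implicit Arguments.
Unset Strict Implicit.
Unset Printing Implicit Defensive.

(** * Integration without measurability and dominated convergence *)

Section integral_bounds.
Context d (T : measurableType d) (R : realType).
Variable mu : {measure set T -> \bar R}.
Implicit Types (D : set T) (h phi : T -> R).

(* The integral of a nonnegative function is a supremum over the simple
   functions below it, so monotonicity needs no measurability. *)
Lemma ge0_le_integral_nomeas D (f1 f2 : T -> \bar R) :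
  (forall x, D x -> 0 <= f1 x)%E -> (forall x, D x -> f1 x <= f2 x)%E ->
  (\int[mu]_(x in D) f1 x <= \int[mu]_(x in D) f2 x)%E.
Proof.
move=> f10 f12; have f20 x : D x -> (0 <= f2 x)%E.
  by move=> Dx; exact: le_trans (f10 x Dx) (f12 x Dx).
rewrite !ge0_integralE//; apply: ereal_sup_le => _ [g /= gf <-].
exists g => //= x; apply: le_trans (gf x) _.
by rewrite /patch; case: ifPn => // /set_mem; exact: f12.
Qed.

(** The larger integral must be finite because [fine] sends [+oo] to 0, which could reverse the
    inequality. *)
Lemma ge0_le_Rintegral_nomeas D (f1 f2 : T -> R) :
  (forall x, D x -> 0 <= f1 x) -> (forall x, D x -> f1 x <= f2 x) ->
  (\int[mu]_(x in D) (f2 x)%:E < +oo)%E ->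
  \int[mu]_(x in D) f1 x <= \int[mu]_(x in D) f2 x.
Proof.
move=> f10 f12 f2y.
have i1 : (0 <= \int[mu]_(x in D) (f1 x)%:E)%E.
  by apply: integral_ge0 => x Dx; rewrite lee_fin f10.
have i12 : (\int[mu]_(x in D) (f1 x)%:E <= \int[mu]_(x in D) (f2 x)%:E)%E.
  by apply: ge0_le_integral_nomeas => x Dx; rewrite lee_fin ?f10 ?f12.
apply: fine_le => //; rewrite ge0_fin_numE//.
- exact: le_lt_trans i12 f2y.
- exact: le_trans i1 i12.
Qed.

Lemma integrable_mul_bounded h phi (M : R) :
  mu.-integrable setT (EFin \o h) -> measurable_fun setT phi ->
  (forall x, `|phi x| <= M) ->
  mu.-integrable setT (EFin \o (fun x => h x * phi x)).
Proof.
move=> ih mphi bphi.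
have -> : EFin \o (fun x => h x * phi x) = ((EFin \o h) \* (EFin \o phi))%E.
  by apply/funext => x /=; rewrite EFinM.
apply: integrableMl => //.
exists M; split; first exact: num_real.
by move=> N MN x _ /=; exact: le_trans (bphi x) (ltW MN).
Qed.

(** Dominated convergence with majorant M |h|. It serves twice: for limits of test functions of Y,
    and for continuity of E[h e^{i<s,Y>}] in s. *)
Lemma cvg_Rintegral_mul h (phi_ : nat -> T -> R) phi (M : R) :
  mu.-integrable setT (EFin \o h) ->
  (forall n, measurable_fun setT (phi_ n)) ->
  (forall n x, `|phi_ n x| <= M) ->
  (forall x, phi_ n x @[n --> \oo] --> phi x) ->
  measurable_fun setT phi /\
  \int[mu]_x (h x * phi_ n x) @[n --> \oo] --> \int[mu]_x (h x * phi x).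
Proof.
move=> ih mphi_ bphi_ cphi.
have mphi : measurable_fun setT phi.
  by apply: (@measurable_fun_cvg _ _ _ setT phi_) => // x _; exact: cphi.
split=> //.
have bphi x : `|phi x| <= M.
  apply: (cvgr_to_le (cvg_norm (cphi x))).
  by apply: nearW => n; exact: bphi_.
have mh : measurable_fun setT h by exact/measurable_EFinP/measurable_int/ih.
have iphi := integrable_mul_bounded ih mphi bphi.
apply: fine_cvg; rewrite fineK; last exact: integrable_fin_num.
have [| | | | |_ _ //] := @dominated_convergence _ _ _ mu setT measurableT
  (fun n x => (h x * phi_ n x)%:E) (fun x => (h x * phi x)%:E)
  (fun x => (`|h x| * M)%:E).
- by move=> n; apply/measurable_EFinP; exact: measurable_funM.
- by apply/measurable_EFinP; exact: measurable_funM.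
- apply: aeW => x _; apply: cvg_EFin; first exact: nearW.
  by apply: cvgM; [exact: cvg_cst|exact: cphi].
- under eq_fun do rewrite EFinM.
  exact: integrableZr (integrable_norm ih).
- by apply: aeW => x n _ /=; rewrite lee_fin normrM ler_wpM2l.
Qed.

End integral_bounds.

(** * Trigonometric polynomials *)

Section sign_iteration.
Variable R : realType.
Implicit Types u : R.

(* Newton's iteration for u^-2 = 1: an odd polynomial map preserving [-1, 1]
   whose iterates converge pointwise to the sign. *)
Definition sgn_step u : R := u * (3 - u ^+ 2) / 2.

Lemma sgn_stepN u : sgn_step (- u) = - sgn_step u.
Proof. by rewrite /sgn_step sqrrN !mulNr. Qed.

Lemma iter_sgn_stepN n u : iter n sgn_step (- u) = - iter n sgn_step u.
Proof. by elim: n => //= n ->; rewrite sgn_stepN. Qed.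

(** One step multiplies the error 1 - v by (1 - v)(2 + v)/2 = 1 - (v + v^2)/2. The iterates never
    drop below u, so this factor is at most 1 - u/2. *)
Lemma iter_sgn_step_ge0 n u : 0 <= u <= 1 ->
  u <= iter n sgn_step u <= 1 /\
  1 - iter n sgn_step u <= (1 - u / 2) ^+ n.
Proof.
move=> /andP[u0 u1]; elim: n => [|n [/andP[]]].
  by rewrite /= lexx u1 expr0; split => //; lra.
rewrite iterS; set v := iter n sgn_step u; move=> uv v1 IH.
have -> : sgn_step v = 1 - (1 - v) * ((1 - v) * (2 + v) / 2).
  by rewrite /sgn_step; field.
have v0 : 0 <= v by exact: le_trans uv.
have h0 : 0 <= (1 - v) * (2 + v) / 2 by rewrite divr_ge0// mulr_ge0; lra.
have h1 : (1 - v) * (2 + v) / 2 <= 1 - u / 2 by nra.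
split; last first.
  rewrite opprB addrC subrK exprS mulrC ler_pM//; lra.
apply/andP; split; last by rewrite gerBl mulr_ge0//; lra.
apply: le_trans uv _; nra.
Qed.

Lemma norm_iter_sgn_step n u : `|u| <= 1 -> `|iter n sgn_step u| <= 1.
Proof.
wlog u0 : u / 0 <= u.
  move=> H; have [|/ltW u0] := leP 0 u; first exact: H.
  move=> u1; rewrite -(opprK u) iter_sgn_stepN normrN.
  by apply: H; rewrite ?oppr_ge0// normrN.
rewrite ger0_norm// => u1; have [|/andP[uv v1] _] := @iter_sgn_step_ge0 n u.
  by rewrite u0.
by rewrite ger0_norm// (le_trans u0).
Qed.

Lemma cvg_iter_sgn_step u : `|u| <= 1 ->
  iter n sgn_step u @[n --> \oo] --> Num.sg u.
Proof.
wlog u0 : u / 0 <= u.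
  move=> H; have [|/ltW u0] := leP 0 u; first exact: H.
  move=> u1; rewrite -(opprK u) sgrN.
  under eq_fun do rewrite iter_sgn_stepN.
  by apply: cvgN; apply: H; rewrite ?oppr_ge0// normrN.
rewrite ger0_norm// => u1.
(* At u = 0 the rate 1 - u/2 equals 1 and gives nothing, but 0 is a fixed point. *)
have [->|un0] := eqVneq u 0.
  rewrite sgr0 (_ : (fun n => _) = fun=> 0); first exact: cvg_cst.
  by apply/funext; elim=> //= n ->; rewrite /sgn_step !mul0r.
have up : 0 < u by rewrite lt_neqAle eq_sym un0.
rewrite gtr0_sg//.
have H n := @iter_sgn_step_ge0 n u.
apply: (@squeeze_cvgr _ _ _ _ (fun n => 1 - (1 - u / 2) ^+ n) (fun=> 1)).
- apply: nearW => n; have [|/andP[_ ->]] := H n; first by rewrite u0.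
  by rewrite andbT lerBlDr -lerBlDl.
- rewrite -[X in _ --> X]subr0; apply: cvgB; first exact: cvg_cst.
  by apply: cvg_expr; rewrite ger0_norm; lra.
- exact: cvg_cst.
Qed.

End sign_iteration.

(** * The algebra of trigonometric polynomials in several variables *)

Section trig_poly.
Variables (R : realType) (q : nat).
Implicit Types (s y : q.-tuple R) (f g : q.-tuple R -> R).

Inductive trig_poly : (q.-tuple R -> R) -> Prop :=
| trig_poly_cos s : trig_poly (fun y => cos (eucl_dot s y))
| trig_poly_sin s : trig_poly (fun y => sin (eucl_dot s y))
| trig_poly_lin a f g : trig_poly f -> trig_poly g ->
    trig_poly (fun y => a * f y + g y).

Lemma eucl_dotD s s' y :
  eucl_dot [tuple tnth s i + tnth s' i | i < q] y = eucl_dot s y + eucl_dot s' y.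
Proof.
by rewrite -big_split; apply: eq_bigr => i _; rewrite tnth_mktuple mulrDl.
Qed.

Lemma eucl_dotB s s' y :
  eucl_dot [tuple tnth s i - tnth s' i | i < q] y = eucl_dot s y - eucl_dot s' y.
Proof.
by rewrite -sumrB; apply: eq_bigr => i _; rewrite tnth_mktuple mulrBl.
Qed.

Lemma eucl_dot_axis (i : 'I_q) (a : R) y :
  eucl_dot [tuple if j == i then a else 0 | j < q] y = a * tnth y i.
Proof.
rewrite /eucl_dot (bigD1 i)//= tnth_mktuple eqxx big1 ?addr0// => j /negPf ji.
by rewrite tnth_mktuple ji mul0r.
Qed.

Lemma trig_poly_scale a f : trig_poly f -> trig_poly (fun y => a * f y).
Proof.
move=> tf; rewrite (_ : (fun y => _) = (fun y => (a - 1) * f y + f y)).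
  exact: trig_poly_lin.
by apply/funext => y; ring.
Qed.

Lemma trig_poly_cst a : trig_poly (fun=> a).
Proof.
rewrite (_ : (fun=> a) = (fun y => a * cos (eucl_dot [tuple 0 | i < q] y))).
  exact/trig_poly_scale/trig_poly_cos.
apply/funext => y; rewrite /eucl_dot big1 ?cos0 ?mulr1// => i _.
by rewrite tnth_mktuple mul0r.
Qed.

(** Product-to-sum formulas treat the generators, producing the frequencies s - s' and s + s'; a
    double induction extends them bilinearly. *)
Lemma trig_polyM f g : trig_poly f -> trig_poly g ->
  trig_poly (fun y => f y * g y).
Proof.
have lin2 a b f1 f2 h : trig_poly f1 -> trig_poly f2 ->
    (forall y, h y = a * f1 y + b * f2 y) -> trig_poly h.
  move=> tf1 tf2 hE; rewrite (_ : h = fun y => a * f1 y + b * f2 y).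
    by apply: trig_poly_lin => //; exact: trig_poly_scale.
  exact/funext.
move=> + tg; elim=> {f} [s|s|a f1 f2 _ H1 _ H2]; last first.
  by apply: (lin2 a 1 _ _ _ H1 H2) => y; ring.
- elim: tg => {g} [s'|s'|a f1 f2 _ H1 _ H2]; last first.
  + by apply: (lin2 a 1 _ _ _ H1 H2) => y; ring.
  + apply: (lin2 (1/2) (-1/2)).
    * exact: trig_poly_cos [tuple tnth s i - tnth s' i | i < q].
    * exact: trig_poly_cos [tuple tnth s i + tnth s' i | i < q].
    * by move=> y /=; rewrite eucl_dotB eucl_dotD cosB cosD; field.
  + apply: (lin2 (1/2) (1/2)).
    * exact: trig_poly_sin [tuple tnth s i - tnth s' i | i < q].
    * exact: trig_poly_sin [tuple tnth s i + tnth s' i | i < q].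
    * by move=> y /=; rewrite eucl_dotB eucl_dotD sinB sinD; field.
- elim: tg => {g} [s'|s'|a f1 f2 _ H1 _ H2]; last first.
  + by apply: (lin2 a 1 _ _ _ H1 H2) => y; ring.
  + apply: (lin2 (-1/2) (1/2)).
    * exact: trig_poly_sin [tuple tnth s i - tnth s' i | i < q].
    * exact: trig_poly_sin [tuple tnth s i + tnth s' i | i < q].
    * by move=> y /=; rewrite eucl_dotB eucl_dotD sinB sinD; field.
  + apply: (lin2 (1/2) (1/2)).
    * exact: trig_poly_cos [tuple tnth s i - tnth s' i | i < q].
    * exact: trig_poly_cos [tuple tnth s i + tnth s' i | i < q].
    * by move=> y /=; rewrite eucl_dotB eucl_dotD cosB cosD; field.
Qed.

(** The subtraction formula moves the shift [a] out of the argument, into the coefficients of a sine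
    and a cosine of frequency 1/b along one axis. *)
Lemma trig_poly_axis_sin (i : 'I_q) (a b : R) :
  trig_poly (fun y => sin ((tnth y i - a) / b)).
Proof.
pose s := [tuple if j == i then b^-1 else 0 | j < q].
rewrite (_ : (fun y => _) = (fun y => cos (a / b) * sin (eucl_dot s y) +
    - sin (a / b) * cos (eucl_dot s y))).
  apply: trig_poly_lin; first exact: trig_poly_sin.
  exact/trig_poly_scale/trig_poly_cos.
apply/funext => y; rewrite eucl_dot_axis mulrBl sinB (mulrC b^-1).
by ring.
Qed.

Lemma trig_poly_sgn_step f n : trig_poly f ->
  trig_poly (fun y => iter n (@sgn_step R) (f y)).
Proof.
move=> tf; elim: n => //= n IH.
rewrite (_ : (fun y => _) = (fun y => iter n (@sgn_step R) (f y) *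
    (- (1/2) * (iter n (@sgn_step R) (f y) * iter n (@sgn_step R) (f y)) + 3/2))).
  apply: trig_polyM => //; apply: trig_poly_lin; first exact: trig_polyM.
  exact: trig_poly_cst.
by apply/funext => y; rewrite /sgn_step; field.
Qed.

Lemma trig_poly_prod (I : Type) (l : seq I) (F : I -> q.-tuple R -> R) :
  (forall i, trig_poly (F i)) -> trig_poly (fun y => \prod_(i <- l) F i y).
Proof.
move=> tF; elim: l => [|i l IH].
  by under eq_fun do rewrite big_nil; exact: trig_poly_cst.
by under eq_fun do rewrite big_cons; exact: trig_polyM.
Qed.

Lemma measurable_eucl_dot s : measurable_fun setT (eucl_dot s).
Proof.
apply: measurable_sum => i; apply: measurable_funM => //.
exact: measurable_tnth.
Qed.

Lemma measurable_cos_dot s : measurable_fun setT (fun y => cos (eucl_dot s y)).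
Proof.
apply: measurableT_comp; last exact: measurable_eucl_dot.
by apply: continuous_measurable_fun; exact: continuous_cos.
Qed.

Lemma measurable_sin_dot s : measurable_fun setT (fun y => sin (eucl_dot s y)).
Proof.
apply: measurableT_comp; last exact: measurable_eucl_dot.
by apply: continuous_measurable_fun; exact: continuous_sin.
Qed.

End trig_poly.

(** * Uniqueness of the Fourier transform *)

Section orthant.
Variables (R : realType) (q : nat).
Implicit Types (y : q.-tuple R) (l : seq ('I_q * R)) (p : 'I_q * R).

Definition above y p : bool := p.2 < tnth y p.1.

(** A finite list of constraints, with repeated coordinates allowed: the empty list is the whole
    space and concatenation is intersection, so these sets form a pi-system. *)
Definition orthant l : set (q.-tuple R) := [set y | all (above y) l].

(* The shift by 1/(m+1) makes the limit 0, not 1/2, at tnth y p.1 = p.2. *)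
Definition ray_arg (m : nat) p y : R :=
  sin ((tnth y p.1 - (p.2 + m.+1%:R^-1)) / m.+1%:R).

Definition ray_approx (k m : nat) p y : R :=
  1/2 * iter k (@sgn_step R) (ray_arg m p y) + 1/2.

Lemma norm_ray_arg m p y : `|ray_arg m p y| <= 1.
Proof. by rewrite ler_norml sin_geN1 sin_le1. Qed.

(** The sine has the sign of its argument on ]-pi, pi[. For large m the argument lies there, and the
    shift makes it nonzero with the right sign, so the value is eventually exact and not only a
    limit. *)
Lemma sgn_ray_arg p y : \forall m \near \oo,
  1/2 * Num.sg (ray_arg m p y) + 1/2 = (above y p)%:R.
Proof.
rewrite /ray_arg /above; set z := tnth y p.1 - p.2.
near=> m; set n : R := m.+1%:R.
have n0 : 0 < n by rewrite /n ltr0n.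
(* The part |z| + 1 keeps the argument of the sine within ]-pi, pi[; the part 1/|z| gives 1/n < z
   when z > 0, and is 0 by convention at z = 0. *)
have nM : `|z| + 1 + `|z|^-1 < n.
  apply: (@lt_trans _ _ m%:R); last by rewrite /n ltr_nat.
  by near: m; exact: nbhs_infty_gtr.
have nz0 : 0 <= `|z|^-1 by rewrite invr_ge0.
have nz : `|z| + 1 < n by apply: le_lt_trans nM; rewrite lerDl.
have n1 : n^-1 < 1 by rewrite invf_lt1// (le_lt_trans _ nz)// lerDr.
have nV0 : 0 < n^-1 by rewrite invr_gt0.
have npi : n <= pi * n by rewrite ler_peMl ?(ltW n0)//; have := pi_ge2 R; lra.
rewrite opprD addrA -/z.
have [az|za] := ltP p.2 (tnth y p.1).
  have zp : 0 < z by rewrite subr_gt0.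
  have zn : n^-1 < z.
    rewrite invf_plt ?posrE//; apply: le_lt_trans nM.
    by rewrite (gtr0_norm zp) lerDr; lra.
  rewrite gtr0_sg; first by rewrite mulr1 -mulrDl divff.
  apply: sin_gt0_pi; rewrite divr_gt0 ?subr_gt0//=.
  rewrite ltr_pdivrMr//; move: nz; rewrite (gtr0_norm zp) => nz.
  by clearbody n z; lra.
have zp : z <= 0 by rewrite subr_le0.
rewrite ltr0_sg; first by rewrite mulrN1 addrC subrr.
rewrite -oppr_gt0 -sinN; apply: sin_gt0_pi.
rewrite -mulNr divr_gt0 ?oppr_gt0//=; last by clearbody n z; lra.
rewrite ltr_pdivrMr//; move: nz; rewrite (ler0_norm zp) => nz.
by clearbody n z; lra.
Unshelve. all: by end_near. Qed.

Lemma trig_poly_ray_approx k m p : trig_poly (ray_approx k m p).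
Proof.
apply: trig_poly_lin; last exact: trig_poly_cst.
exact/trig_poly_sgn_step/trig_poly_axis_sin.
Qed.

Lemma ray_approx_itv k m p y : 0 <= ray_approx k m p y <= 1.
Proof.
have := norm_iter_sgn_step k (norm_ray_arg m p y).
by rewrite ler_norml /ray_approx => /andP[]; lra.
Qed.

Lemma norm_prod_le1 (I : Type) (l : seq I) (F : I -> R) :
  (forall i, 0 <= F i <= 1) -> `|\prod_(i <- l) F i| <= 1.
Proof.
move=> F01; rewrite ger0_norm; last first.
  by apply: prodr_ge0 => i _; have /andP[] := F01 i.
elim: l => [|i l IH]; first by rewrite big_nil.
rewrite big_cons mulr_ile1//; first by have /andP[] := F01 i.
- by apply: prodr_ge0 => j _; have /andP[] := F01 j.
- by have /andP[] := F01 i.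
Qed.

Lemma indic_orthant l y :
  \1_(orthant l) y = \prod_(p <- l) (above y p)%:R :> R.
Proof.
rewrite indicE; elim: l => [|p l IH].
  by rewrite big_nil mem_set.
rewrite big_cons -IH -natrM mulnb; congr (_ %:R); congr nat_of_bool.
by apply/idP/andP; rewrite !inE /orthant /= => /andP.
Qed.

Lemma measurable_tuple_orthant :
  @measurable _ (q.-tuple R) = <<s range orthant >>.
Proof.
apply/seteqP; split; last first.
  apply: smallest_sub; first exact: sigma_algebra_measurable.
  move=> _ [l _ <-].
  elim: l => [|p l IH]; first by rewrite (_ : orthant _ = setT)//; apply/seteqP.
  rewrite (_ : orthant _ = (tnth (T:=R) ^~ p.1) @^-1` `]p.2, +oo[ `&` orthant l).
    apply: measurableI => //; rewrite -[X in measurable X]setTI.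
    by apply: measurable_tnth => //; exact: measurable_itv.
  apply/seteqP; split => y; rewrite /orthant /above /=.
    by move=> /andP[py yl]; split => //; rewrite in_itv/= andbT.
  by rewrite in_itv/= andbT => -[-> ->].
(* The same points under the sigma-algebra generated by orthants. The identity from [T'] is
   measurable once its coordinates are, and this is the remaining inclusion. *)
pose T' := g_sigma_algebraType (range orthant).
have : measurable_fun [set: T'] (id : T' -> q.-tuple R).
  apply/measurable_fun_tnthP => i.
  apply: (measurability _ (RGenOInfty.measurableE R)) => //.
  move=> _ [_ [x ->] <-]; rewrite setTI.
  apply: sub_sigma_algebra; exists [:: (i, x)] => //.
by move=> mid B mB; have := mid measurableT B mB; rewrite setTI.
Qed.

Lemma setI_closed_orthant : setI_closed (range orthant).
Proof.
move=> _ _ [l _ <-] [l' _ <-]; exists (l ++ l') => //.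
by apply/seteqP; split => y; rewrite /orthant /= all_cat => /andP.
Qed.

End orthant.

(** * Functions of Y orthogonal to h: from exponentials to indicators *)

Section fourier_uniqueness.
Context d (T : measurableType d) (R : realType) (mu : {measure set T -> \bar R}).
Variables (q : nat) (h : T -> R) (Y : T -> q.-tuple R).
Hypothesis ih : mu.-integrable setT (EFin \o h).
Hypothesis mY : measurable_fun setT Y.
Implicit Types f g : q.-tuple R -> R.

(** Measurability and a bound are bundled with the equation so that h f(Y) is integrable and its
    zero integral is a genuine value, not a default. *)
Definition annihilated f : Prop :=
  [/\ measurable_fun setT f, exists M : R, forall y, `|f y| <= M &
      \int[mu]_x (h x * f (Y x)) = 0].

Lemma annihilated_lin a f g : annihilated f -> annihilated g ->
  annihilated (fun y => a * f y + g y).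
Proof.
move=> [mf [M fM] f0] [mg [N gN] g0]; split.
- by apply: measurable_funD => //; exact: measurable_funM.
- exists (`|a| * M + N) => y; apply: le_trans (ler_normD _ _) _.
  by rewrite lerD// normrM ler_wpM2l.
- have I f' N' : measurable_fun setT f' -> (forall y, `|f' y| <= N') ->
      mu.-integrable setT (EFin \o (fun x => h x * f' (Y x))).
    move=> mf' bf'; apply: (@integrable_mul_bounded _ _ _ _ _ _ N') => //.
    exact: measurableT_comp.
  have fi := I _ _ mf fM; have gi := I _ _ mg gN.
  transitivity (\int[mu]_x (a * (h x * f (Y x)) + h x * g (Y x))).
    by apply: eq_Rintegral => x _; ring.
  rewrite RintegralD//; last exact: (integrableZl measurableT a fi).
  by rewrite RintegralZl// f0 g0 mulr0 addr0.
Qed.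

Lemma annihilated_cvg (f_ : nat -> q.-tuple R -> R) f (M : R) :
  (forall n, annihilated (f_ n)) -> (forall n y, `|f_ n y| <= M) ->
  (forall y, f_ n y @[n --> \oo] --> f y) -> annihilated f.
Proof.
move=> af bf cf.
have mf : measurable_fun setT f.
  apply: (@measurable_fun_cvg _ _ _ setT f_) => [n|y _]; last exact: cf.
  by have [] := af n.
split => //.
- exists M => y; apply: (cvgr_to_le (cvg_norm (cf y))).
  by apply: nearW => n; exact: bf.
- have [] := @cvg_Rintegral_mul _ _ _ mu h (fun n x => f_ n (Y x))
    (fun x => f (Y x)) M ih.
  + by move=> n; apply: measurableT_comp mY; have [] := af n.
  + by move=> n x; exact: bf.
  + by move=> x; exact: cf.
  + move=> _; rewrite (_ : (fun n => _) = fun=> 0); last first.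
      by apply/funext => n; have [] := af n.
    by move/cvg_lim => <-//; rewrite lim_cst.
Qed.

Hypothesis hcos : forall s, \int[mu]_x (h x * cos (eucl_dot s (Y x))) = 0.
Hypothesis hsin : forall s, \int[mu]_x (h x * sin (eucl_dot s (Y x))) = 0.

Lemma annihilated_trig_poly f : trig_poly f -> annihilated f.
Proof.
elim=> {f} [s|s|a f g _ af _ ag]; last exact: annihilated_lin.
- split; [exact: measurable_cos_dot| |exact: hcos].
  by exists 1 => y; rewrite ler_norml cos_geN1 cos_le1.
- split; [exact: measurable_sin_dot| |exact: hsin].
  by exists 1 => y; rewrite ler_norml sin_geN1 sin_le1.
Qed.

(** Two successive limits of products: first in k, turning the iterates into signs for fixed m, then
    in m, turning the signs into indicators of rays. *)
Lemma annihilated_orthant l : annihilated (\1_(orthant l)).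
Proof.
have -> : \1_(orthant l) = fun y => \prod_(p <- l) (above y p)%:R :> R.
  by apply/funext => y; rewrite indic_orthant.
pose F m (p : 'I_q * R) (y : q.-tuple R) : R := 1/2 * Num.sg (ray_arg m p y) + 1/2.
have F01 m p y : 0 <= F m p y <= 1.
  by rewrite /F; case: sgrP => _; lra.
apply: (@annihilated_cvg (fun m y => \prod_(p <- l) F m p y) _ 1).
- move=> m.
  apply: (@annihilated_cvg (fun k y => \prod_(p <- l) ray_approx k m p y) _ 1).
  + move=> k; apply: annihilated_trig_poly; apply: trig_poly_prod => p.
    exact: trig_poly_ray_approx.
  + by move=> k y; apply: norm_prod_le1 => p; exact: ray_approx_itv.
  + move=> y; apply: cvg_big => [|p _]; first exact: mul_continuous.
    apply: cvgD; last exact: cvg_cst.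
    apply: cvgM; first exact: cvg_cst.
    exact/cvg_iter_sgn_step/norm_ray_arg.
- by move=> m y; apply: norm_prod_le1 => p; exact: F01.
- move=> y; apply: cvg_big => [|p _]; first exact: mul_continuous.
  apply: cvg_near_cst.
  exact: sgn_ray_arg.
Qed.

Lemma annihilated_indic B : measurable B -> annihilated (\1_B).
Proof.
have aT : annihilated (\1_[set: q.-tuple R]).
  rewrite (_ : setT = orthant [::]); first exact: annihilated_orthant.
  exact/esym/seteqP.
rewrite measurable_tuple_orthant; move: B.
apply: (@dynkin_induction _ (q.-tuple R) (range (@orthant R q))) => //.
- exact: measurable_tuple_orthant.
- exact: setI_closed_orthant.
- by move=> _ [l _ <-]; exact: annihilated_orthant.
- move=> B _ aB; rewrite (_ : \1_(~` B) = fun y => -1 * \1_B y + \1_setT y).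
    exact: annihilated_lin.
  by apply/funext => y; rewrite !indicE in_setC in_setT; case: (_ \in _) => /=; ring.
- move=> F mF tF aF.
  (* By disjointness a point of [F k] is counted once, from n = k + 1 on: the partial sums take only
     the values 0 and 1 and are eventually constant. *)
  have FE y n k : F k y -> (\sum_(i < n) \1_(F i) y = (k < n)%N%:R :> R).
    move=> Fky; rewrite (eq_bigr (fun i : 'I_n => (val i == k)%:R)).
      elim: n => [|n IH]; first by rewrite big_ord0.
      rewrite big_ord_recr/= IH ltnS (leq_eqVlt k n) (eq_sym n).
      by case: (ltngtP k n) => _ /=; rewrite ?addr0 ?add0r.
    move=> i _; rewrite indicE; congr (_%:R); congr nat_of_bool.
        apply/idP/eqP => [|->]; last by rewrite mem_set.
    by rewrite inE => Fiy; apply: (tF i k) => //; exists y.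
  have F0 y n : ~ (\bigcup_k F k) y -> (\sum_(i < n) \1_(F i) y = 0 :> R).
    move=> nF; rewrite big1// => i _; rewrite indicE memNset//.
    by move=> Fi; apply: nF; exists i.
  apply: (@annihilated_cvg (fun n y => \sum_(i < n) \1_(F i) y) _ 1).
  + elim=> [|n IH].
      rewrite (_ : (fun y => _) = fun y => -1 * \1_setT y + \1_setT y).
        exact: annihilated_lin.
      by apply/funext => y; rewrite big_ord0; ring.
    rewrite (_ : (fun y => _) = fun y => 1 * \sum_(i < n) \1_(F i) y + \1_(F n) y).
      exact: annihilated_lin.
    by apply/funext => y; rewrite big_ord_recr/= mul1r.
  + move=> n y; have [[k _ Fky]|nF] := pselect ((\bigcup_k F k) y).
      by rewrite (FE y n k Fky) ger0_norm ?ler0n// lern1; case: (_ < _)%N.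
    by rewrite F0// normr0.
  + move=> y; apply: cvg_near_cst.
    have [[k _ Fky]|nF] := pselect ((\bigcup_k F k) y).
      exists k.+1 => // n /= kn; rewrite (FE y n k Fky) kn indicE mem_set//.
      by exists k.
    by apply: nearW => n; rewrite F0// indicE memNset.
Qed.

End fourier_uniqueness.

(** * From indicators back to bounded measurable functions *)

Section annihilated_of_indic.
Context d (T : measurableType d) (R : realType) (mu : {measure set T -> \bar R}).
Variables (q : nat) (h : T -> R) (Y : T -> q.-tuple R).
Hypothesis ih : mu.-integrable setT (EFin \o h).
Hypothesis mY : measurable_fun setT Y.
Hypothesis hindic : forall B, measurable B -> \int[mu]_x (h x * \1_B (Y x)) = 0.
Import HBNNSimple.

Let annih_indic B : measurable B -> annihilated mu h Y (\1_B).
Proof.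
move=> mB; split; [exact: measurable_indic| |exact: hindic].
by exists 1 => y; rewrite indicE ger0_norm ?ler0n// lern1 leq_b1.
Qed.

Let annih_cst a : annihilated mu h Y (fun=> a).
Proof.
have -> : (fun=> a) = fun y : q.-tuple R => (a - 1) * \1_setT y + \1_setT y.
  by apply/funext => y; rewrite indicE in_setT mulr1 subrK.
by apply: annihilated_lin => //; exact: annih_indic.
Qed.

Let annih_nnsfun (g : {nnsfun q.-tuple R >-> R}) : annihilated mu h Y g.
Proof.
rewrite (_ : (g : _ -> _) =
    fun y => \sum_(r <- finmap.enum_fset (fset_set (range g))) (r * \1_(g @^-1` [set r]) y)).
  elim: (finmap.enum_fset (fset_set (range g))) => [|r l IH].
    under eq_fun do rewrite big_nil; exact: annih_cst.
  under eq_fun do rewrite big_cons.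
  by apply: annihilated_lin => //; exact: annih_indic.
by apply/funext => y; rewrite [LHS]fimfunE fsbig_finite.
Qed.

(** Indicators give simple functions, and these give their bounded pointwise limits. Applied to
    sines and cosines, this yields the converse half of (i). *)
Lemma annihilated_bounded (f : q.-tuple R -> R) (M : R) :
  measurable_fun setT f -> (forall y, `|f y| <= M) -> annihilated mu h Y f.
Proof.
move=> mf bf.
have f0 y : 0 <= f y + M by have := bf y; rewrite ler_norml => /andP[]; lra.
have fM y : f y + M <= M + M by have := bf y; rewrite ler_norml => /andP[]; lra.
(* Approximation from below by simple functions needs a nonnegative function, hence the shift by
   M. *)
rewrite (_ : f = fun y => -1 * M + (f y + M)); last by apply/funext => y; ring.
apply: (annihilated_lin ih mY (-1) (annih_cst M)).
have mfM : measurable_fun setT (fun y => (f y + M)%:E).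
  by apply/measurable_EFinP; exact: measurable_funD.
pose g := nnsfun_approx measurableT mfM.
apply: (@annihilated_cvg _ _ _ _ _ _ _ ih mY (fun n => g n) _ (M + M)).
- by move=> n; exact: annih_nnsfun.
- move=> n y; rewrite ger0_norm; last exact: fun_ge0.
  apply: le_trans (fM y); rewrite -lee_fin /g nnsfun_approxE.
  by apply: le_approx => // z _; rewrite lee_fin.
- move=> y; apply: (@fine_cvg _ _ _ _ (fun n => (g n y)%:E)).
  by apply: cvg_nnsfun_approx => // z _; rewrite lee_fin.
Qed.

End annihilated_of_indic.

(** * Iterated integrals and the Gamma function *)

Section riter.
Variable R : realType.
Notation leb := (@lebesgue_measure R).

Definition dist_le (c r x : R) : bool := `|x - c| <= r.

(** Closed balls of the sup norm: being products of intervals, they let an iterated integral factor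
    coordinate by coordinate. *)
Definition cube n (c : 'I_n -> R) (r : R) (s : n.-tuple R) : bool :=
  [forall i, `|tnth s i - c i| <= r].

Lemma cube_cons n (c : 'I_n.+1 -> R) r x (t : n.-tuple R) :
  cube c r (cons_tuple x t) =
  dist_le (c ord0) r x && cube (c \o lift ord0) r t.
Proof.
apply/forallP/andP => [H|[H0 /forallP H] i].
  split; first exact: (H ord0).
  by apply/forallP => i; have := H (lift ord0 i); rewrite tnthS.
by case: (unliftP ord0 i) => [j ->|->//]; rewrite tnthS; exact: H.
Qed.

Lemma integral_scaled_interval (k c r : R) : 0 <= r ->
  (\int[leb]_x (k * (dist_le c r x)%:R)%:E = (k * (2 * r))%:E)%E.
Proof.
move=> r0.
transitivity (\int[leb]_x (k%:E * (\1_`[c - r, c + r] x)%:E))%E.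
  apply: eq_integral => x _; rewrite indicE EFinM mem_setE in_itv/=.
  by rewrite /dist_le ler_distl.
rewrite integralZl//; last exact: (@integrable_indic_itv R (c - r) (c + r) true false).
rewrite integral_indic//= setIT lebesgue_measure_itv/= lte_fin.
case: ltP => rr; first by rewrite -EFinB -EFinM; congr (_%:E); ring.
have -> : r = 0 by lra.
by rewrite !mulr0 mule0.
Qed.

Lemma Riter_ge0 n (F : n.-tuple R -> R) : (forall s, 0 <= F s) -> 0 <= Riter F.
Proof.
elim: n F => [|n IH] F F0 /=; first exact: F0.
by apply: Rintegral_ge0 => x _; exact: IH.
Qed.

Lemma Riter_cube n (M r : R) (c : 'I_n -> R) : 0 <= r ->
  Riter (fun s => M * (cube c r s)%:R) = M * (2 * r) ^+ n.
Proof.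
move=> r0; elim: n M c => [|n IH] M c /=.
  by rewrite expr0 (_ : cube _ _ _)//; apply/forallP => -[].
transitivity (\int[leb]_x (M * (2 * r) ^+ n * (dist_le (c ord0) r x)%:R)).
  apply: eq_Rintegral => x _.
  (* Once x is fixed its indicator joins the constant, which is why [M] is generalized in the
     induction. *)
  transitivity (Riter (fun t => M * (dist_le (c ord0) r x)%:R *
                                (cube (c \o lift ord0) r t)%:R)).
    by congr Riter; apply/funext => t; rewrite cube_cons -mulnb natrM mulrA.
  by rewrite IH; ring.
by rewrite /Rintegral integral_scaled_interval//= exprS; ring.
Qed.

(** The one-dimensional comparison is iterated. The majorant supported in a cube keeps the integral
    finite at every level, as comparing [fine] values requires. *)
Lemma le_Riter n (F G : n.-tuple R -> R) (M r : R) (c : 'I_n -> R) :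
  0 <= r -> (forall s, 0 <= F s) -> (forall s, F s <= G s) ->
  (forall s, G s <= M * (cube c r s)%:R) -> Riter F <= Riter G.
Proof.
move=> r0; elim: n F G M c => [|n IH] F G M c F0 FG GM /=; first exact: FG.
have G0 s : 0 <= G s := le_trans (F0 s) (FG s).
have GM' x t : G (cons_tuple x t) <=
    M * (dist_le (c ord0) r x)%:R * (cube (c \o lift ord0) r t)%:R.
  by apply: le_trans (GM _) _; rewrite cube_cons -mulnb natrM mulrA.
apply: ge0_le_Rintegral_nomeas => [x _|x _|].
- exact: Riter_ge0.
- by apply: (IH _ _ _ (c \o lift ord0)) => // t; exact: GM'.
(* Finiteness of the outer integral: the induction hypothesis, applied now to [G] and its majorant,
   bounds the inner integrals by an explicit multiple of an indicator. *)
apply: (@le_lt_trans _ _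
    (\int[leb]_x (M * (2 * r) ^+ n * (dist_le (c ord0) r x)%:R)%:E)%E).
  apply: ge0_le_integral_nomeas => x _; rewrite lee_fin; first exact: Riter_ge0.
  rewrite -mulrA (mulrC (_ ^+ n)) mulrA -(Riter_cube _ (c \o lift ord0))//.
  by apply: (IH _ _ _ (c \o lift ord0) _ _ (fun s => lexx _)) => // t; exact: GM'.
by rewrite integral_scaled_interval// ltry.
Qed.

End riter.

(** * Positivity of the Gamma function and of the normalizing constant *)

Section gamma.
Variable R : realType.
Notation leb := (@lebesgue_measure R).

(** A divergent integral would have real value 0, so positivity needs both an upper bound by an
    integrable function and a positive lower bound. *)
Lemma Gamma_gt0 (x : R) : 1 <= x -> 0 < Gamma x.
Proof.
move=> x1; pose p := x - 1; have p0 : 0 <= p by rewrite subr_ge0.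
(* t `^ p <= C * expR (t / 2), from ln u <= u at u = t / a *)
pose a := 2 * p + 1; pose C := expR (p * ln a).
have a0 : 0 < a by rewrite /a; lra.
have powC t : 0 < t -> t `^ p <= C * expR (t / 2).
  move=> t0; rewrite /powR gt_eqF// /C -expRD ler_expR.
  have -> : ln t = ln (t / a) + ln a by rewrite ln_div ?posrE//; ring.
  have lta : ln (t / a) <= t / a.
    by apply/ltW/ln_sublinear; rewrite divr_gt0.
  (* The choice a = 2p + 1 is made for this bound; the added 1 keeps a positive at p = 0. *)
  have pa : p / a <= 1/2 by rewrite ler_pdivrMr// /a; lra.
  rewrite mulrDr addrC lerD2l (le_trans (ler_wpM2l p0 lta))//.
  by rewrite mulrCA ler_pM2l// (le_trans pa)// mul1r.
have fin : (\int[leb]_(t in `]0%R, +oo[) (t `^ (x - 1) * expR (- t))%:E < +oo)%E.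
  (* The integrand is at most C exp(-t/2), which is 2C times the exponential density of rate 1/2. *)
  apply: (@le_lt_trans _ _ (\int[leb]_t ((2 * C)%:E * (exponential_pdf (1/2) t)%:E))%E).
    rewrite integral_mkcond; apply: ge0_le_integral_nomeas => t _.
      by apply: erestrict_ge0 => s _; rewrite lee_fin mulr_ge0// ?powR_ge0 ?expR_ge0.
    rewrite /patch; case: ifPn => [|_].
      rewrite inE/= in_itv/= andbT => t0.
      rewrite -EFinM lee_fin exponential_pdfE ?(ltW t0)//.
      apply: le_trans (ler_wpM2r (expR_ge0 _) (powC _ t0)) _.
      rewrite -mulrA -expRD le_eqVlt; apply/orP; left; apply/eqP.
      have -> : t / 2 - t = - (1/2) * t by field.
      by field.
    rewrite -EFinM lee_fin mulr_ge0//; first by rewrite mulr_ge0 ?expR_ge0.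
    by apply: exponential_pdf_ge0; lra.
  rewrite integralZl//; last by apply: integrable_exponential_pdf; lra.
  by rewrite integral_exponential_pdf ?mule1 ?ltry//; lra.
(* On [1, 2], the interval of centre 3/2 and radius 1/2, the integrand is at least exp(-2). *)
apply: (@lt_le_trans _ _ (\int[leb]_(t in `]0%R, +oo[)
    (expR (- 2) * (dist_le (3/2) (1/2) t)%:R))).
  rewrite Rintegral_mkcond.
  rewrite (_ : _ \_ _ = fun t => expR (- 2) * (dist_le (3/2) (1/2) t)%:R); last first.
    apply/funext => t; rewrite /patch; case: ifPn => // /negP.
    rewrite inE/= in_itv/= andbT => /negP; rewrite -leNgt => t0.
    by rewrite /dist_le; case: (leP (`|_|)); rewrite ?mulr0// ler_norml => /andP[]; lra.
  by rewrite /Rintegral integral_scaled_interval//= mulr_gt0 ?expR_gt0//; lra.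
apply: ge0_le_Rintegral_nomeas fin => t _.
  by rewrite mulr_ge0 ?expR_ge0.
rewrite /dist_le; case: (leP (`|_|)) => [|_]; last first.
  by rewrite mulr0 mulr_ge0 ?powR_ge0 ?expR_ge0.
rewrite ler_norml => /andP[t1 t2].
have {}t1 : 1 <= t by lra.
rewrite mulr1 -[leLHS]mul1r ler_pM// ?expR_ge0//; last by rewrite ler_expR; lra.
have t0 : (0 : R) <= t by lra.
rewrite -[leLHS](congr1 (fun f => f p) (powR1 R)).
by have := @ge0_ler_powR R p p0 1 t; rewrite !nnegrE; apply.
Qed.

Lemma c_q_gt0 (q : nat) : (0 < q)%N -> 0 < c_q q :> R.
Proof.
move=> q0; rewrite divr_gt0 ?powR_gt0 ?pi_gt0// Gamma_gt0//.
by rewrite ler_pdivlMr// mul1r ler_nat ltnS.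
Qed.

End gamma.

(** * Second-order random elements of L^2([0, 1]) *)

Lemma ae_eq_Rintegral d (T : measurableType d) (R : realType)
    (mu : {measure set T -> \bar R}) (D : set T) (f g : T -> R) :
  measurable D -> measurable_fun D f -> measurable_fun D g ->
  {ae mu, forall x, D x -> f x = g x} ->
  \int[mu]_(x in D) f x = \int[mu]_(x in D) g x.
Proof.
move=> mD mf mg fg; congr fine; apply: ae_eq_integral => //.
- exact/measurable_EFinP.
- exact/measurable_EFinP.
- by apply: filterS fg => x fg Dx; rewrite /= fg.
Qed.

(** * Fubini's theorem for real-valued integrals *)

Section fubini_Rintegral.
Context d1 d2 (T1 : measurableType d1) (T2 : measurableType d2) (R : realType).
Variables (m1 : {sigma_finite_measure set T1 -> \bar R})
  (m2 : {sigma_finite_measure set T2 -> \bar R}) (K : T1 * T2 -> R).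
Hypothesis iK : (m1 \x m2)%E.-integrable setT (EFin \o K).

Let integrable_fine d (T : measurableType d) (mu : {measure set T -> \bar R})
    (f : T -> \bar R) : mu.-integrable setT f ->
  mu.-integrable setT (EFin \o (fine \o f)).
Proof.
move=> fi; have mf := measurable_int _ fi.
have mff : measurable_fun setT (EFin \o (fine \o f)).
  by apply/measurable_EFinP; exact: measurableT_comp.
apply: le_integrable fi => // x _ /=.
by case: (f x) => [r| |] //=; rewrite ?normr0 ?leey.
Qed.

(** An integrable extended-valued function is finite almost everywhere, so a pointwise [fine]
    changes it only on a null set. *)
Let Rintegral_fine d (T : measurableType d) (mu : {measure set T -> \bar R})
    (f : T -> \bar R) : mu.-integrable setT f ->
  \int[mu]_x fine (f x) = fine (\int[mu]_x f x)%E.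
Proof.
move=> fi; congr fine; apply: ae_eq_integral => //.
- exact: (measurable_int _ (integrable_fine fi)).
- exact: (measurable_int _ fi).
- apply: filterS (integrable_ae measurableT fi) => x h _ /=.
  by rewrite fineK// h.
Qed.

(** On each section |int K| <= int |K|, and the iterated integral of |K| is finite. *)
Let integrable_G : m2.-integrable setT (fubini_G m1 (EFin \o K)).
Proof.
have mK := measurable_int _ iK.
apply/integrableP; split; first exact: measurable_fubini_G iK.
apply: le_lt_trans ((integrable21ltyP m1 m2 mK).1 iK).
apply: ge0_le_integral_nomeas => y _; first exact: abse_ge0.
apply: le_abse_integral => //.
exact: (measurableT_comp mK (measurable_pair2 y)).
Qed.

Lemma integrable_Rintegral_l :
  m1.-integrable setT (EFin \o (fun x => \int[m2]_y K (x, y))).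
Proof. exact: integrable_fine (integrable_fubini_F iK). Qed.

Lemma integrable_Rintegral_r :
  m2.-integrable setT (EFin \o (fun y => \int[m1]_x K (x, y))).
Proof. exact: integrable_fine integrable_G. Qed.

Lemma Fubini_Rintegral :
  \int[m1]_x \int[m2]_y K (x, y) = \int[m2]_y \int[m1]_x K (x, y).
Proof.
transitivity (fine (\int[m1]_x fubini_F m2 (EFin \o K) x)%E).
  by rewrite -Rintegral_fine//; exact: integrable_fubini_F.
transitivity (fine (\int[m2]_y fubini_G m1 (EFin \o K) y)%E); last first.
  by rewrite -Rintegral_fine//; exact: integrable_G.
by rewrite integral12_prod_meas1// integral21_prod_meas1.
Qed.

End fubini_Rintegral.

(** * Integrability and moments of a second-order random element *)

Section second_order.
Context d (Omega : measurableType d) (R : realType) (P : probability Omega R).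
Notation leb := (@lebesgue_measure R).

Lemma ae_lebS (A B : R -> Prop) : (forall t, A t -> B t) ->
  {ae leb, forall t, A t} -> {ae leb, forall t, B t}.
Proof.
by move=> AB; apply: filterS AB; exact: (ae_filter_ringOfSetsType leb).
Qed.

Lemma measurable_I01 : measurable (@I01 R).
Proof. exact: measurable_itv. Qed.
Hint Resolve measurable_I01 : core.

Lemma ip_mkcond (f g : R -> R) :
  ip f g = \int[leb]_t (f t * (g \_ I01) t).
Proof.
rewrite /ip Rintegral_mkcond; congr (Rintegral leb setT).
by apply/funext => t; rewrite /patch; case: ifP => _; rewrite ?mulr0.
Qed.

Lemma L2_restrict (f : R -> R) : L2 f ->
  measurable_fun setT (f \_ I01) /\
  (\int[leb]_t (((f \_ I01) t) ^+ 2)%:E < +oo)%E.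
Proof.
move=> [mf f2]; split; first by apply/measurable_restrict => //; rewrite setTI.
move: f2; rewrite integral_mkcond; congr (_ < _)%E.
apply: eq_integral => t _; rewrite /patch; case: ifP => _ //.
by rewrite expr0n.
Qed.

Lemma L2_bounded (f : R -> R) (M : R) :
  measurable_fun I01 f -> (forall t, I01 t -> `|f t| <= M) -> L2 f.
Proof.
move=> mf bf; split => //.
apply: (@le_lt_trans _ _ (\int[leb]_(t in I01) (M ^+ 2)%:E)%E).
  apply: ge0_le_integral_nomeas => t It; rewrite lee_fin ?sqr_ge0//.
  by rewrite -(real_normK (num_real (f t))) ler_pXn2r ?nnegrE// ?bf// (le_trans _ (bf _ It)).
rewrite integral_cst//= lebesgue_measure_itv/= lte01.
by rewrite oppr0 adde0 mule1 ltry.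
Qed.

Variable X : Omega -> R -> R.
Hypothesis mX : random_element X.
Hypothesis X2 : (\int[P]_w \int[leb]_(t in I01) ((X w t) ^+ 2)%:E < +oo)%E.

Let XI (p : Omega * R) : R := X p.1 p.2 * \1_I01 p.2.

Let mXI : measurable_fun setT XI.
Proof.
by apply: measurable_funM => //; exact: measurableT_comp.
Qed.

Let mXI2 : measurable_fun setT (fun p => (XI p ^+ 2)%:E).
Proof. by apply/measurable_EFinP; exact: measurable_funX. Qed.

Let XI2E w : (\int[leb]_t (XI (w, t) ^+ 2)%:E =
  \int[leb]_(t in I01) ((X w t) ^+ 2)%:E)%E.
Proof.
rewrite [RHS]integral_mkcond; apply: eq_integral => t _.
rewrite /XI /= indicE /patch; case: ifP => _; first by rewrite mulr1.
by rewrite mulr0 expr0n.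
Qed.

Lemma measurable_sqnorm :
  measurable_fun setT (fun w => \int[leb]_(t in I01) ((X w t) ^+ 2)%:E)%E.
Proof.
under eq_fun do rewrite -XI2E.
apply: (@measurable_fun_fubini_tonelli_F _ _ _ _ _ leb
  (fun p => (XI p ^+ 2)%:E) mXI2).
by move=> p; rewrite lee_fin sqr_ge0.
Qed.

Lemma measurable_section w : measurable_fun I01 (X w).
Proof.
apply: measurable_funTS.
exact: (measurableT_comp mX (measurable_pair1 w)).
Qed.

(** The squared norm has finite expectation, hence is finite almost surely, though possibly not for
    every w. *)
Lemma ae_L2_section : {ae P, forall w, L2 (X w)}.
Proof.
have iX : P.-integrable setT (fun w => \int[leb]_(t in I01) ((X w t) ^+ 2)%:E)%E.
  apply/integrableP; split; first exact: measurable_sqnorm.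
  apply: le_lt_trans X2; apply: ge0_le_integral_nomeas => w _ //.
  by rewrite gee0_abs//; apply: integral_ge0 => t _; rewrite lee_fin sqr_ge0.
apply: filterS (integrable_ae measurableT iX) => w /(_ Logic.I) wfin.
split; first exact: measurable_section.
by move: wfin; rewrite fin_numE => /andP[_]; rewrite -ltey.
Qed.

Section test_function.
Variables (f : R -> R) (phi : Omega -> R) (M : R).
Hypotheses (L2f : L2 f) (mphi : measurable_fun setT phi)
  (bphi : forall w, `|phi w| <= M).
Let f0 : R -> R := f \_ I01.

Let f0E t : f0 t = \1_I01 t * f0 t.
Proof. by rewrite indicE /f0 /patch; case: ifP; rewrite ?mul1r ?mul0r. Qed.

Let kern (p : Omega * R) : R := X p.1 p.2 * phi p.1 * f0 p.2.

(** The majorant M (X(t)^2 + f(t)^2) on [0, 1] integrates to M (E||X||^2 + ||f||^2), which opens the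
    way to Fubini. *)
Lemma integrable_kern : (P \x leb)%E.-integrable setT (EFin \o kern).
Proof.
have [mf0 f02] := L2_restrict L2f; rewrite -/f0 in mf0 f02.
have M0 : 0 <= M by exact: le_trans (normr_ge0 _) (bphi point).
have mk : measurable_fun setT (EFin \o kern).
  apply/measurable_EFinP; apply: measurable_funM.
    by apply: measurable_funM => //; exact: measurableT_comp.
  exact: measurableT_comp.
apply/integrable12ltyP => //.
have iXI w : (0 <= \int[leb]_t (XI (w, t) ^+ 2)%:E)%E.
  by apply: integral_ge0 => t _; rewrite lee_fin sqr_ge0.
have if0 : (0 <= \int[leb]_t (f0 t ^+ 2)%:E)%E.
  by apply: integral_ge0 => t _; rewrite lee_fin sqr_ge0.
apply: (@le_lt_trans _ _ (\int[P]_w (M%:E * (\int[leb]_t (XI (w, t) ^+ 2)%:E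
    + \int[leb]_t (f0 t ^+ 2)%:E)))%E).
  apply: ge0_le_integral_nomeas => w _; first exact: integral_ge0.
  rewrite -ge0_integralD//; first last.
  - by apply/measurable_EFinP; exact: measurable_funX.
  - by move=> t _; rewrite lee_fin sqr_ge0.
  - by apply: (measurableT_comp mXI2); exact: measurable_pair1.
  - by move=> t _; rewrite lee_fin sqr_ge0.
  rewrite -ge0_integralZl//; last 2 first.
  - apply: emeasurable_funD.
      by apply: (measurableT_comp mXI2); exact: measurable_pair1.
    by apply/measurable_EFinP; exact: measurable_funX.
  - by move=> t _; rewrite -EFinD lee_fin addr_ge0 ?sqr_ge0.
  apply: ge0_le_integral_nomeas => t _ /=; first by rewrite lee_fin.
  (* The cutoff of [f0] is duplicated and handed to X; then |a b| <= a^2 + b^2 concludes. *)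
  rewrite -EFinD -EFinM lee_fin /kern /= [in leLHS]f0E.
  rewrite (_ : _ * _ = phi w * (XI (w, t) * f0 t)); last by rewrite /XI/=; ring.
  rewrite normrM ler_pM// normrM -(real_normK (num_real (XI (w, t)))).
  rewrite -(real_normK (num_real (f0 t))).
  have := sqr_ge0 (`|XI (w, t)| - `|f0 t|).
  by have := normr_ge0 (XI (w, t)); have := normr_ge0 (f0 t); nra.
rewrite ge0_integralZl//; last 2 first.
- apply: emeasurable_funD => //.
  by under eq_fun do rewrite XI2E; exact: measurable_sqnorm.
- by move=> w _; rewrite adde_ge0.
rewrite ge0_integralD//; last first.
  by under eq_fun do rewrite XI2E; exact: measurable_sqnorm.
rewrite integral_cst//= probability_setT mule1.
under eq_integral do rewrite XI2E.
apply: lte_mul_pinfty; rewrite ?lee_fin//.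
by rewrite lte_add_pinfty.
Qed.

End test_function.

Let norm_cst1 (w : Omega) : `|cst 1 w : R| <= 1.
Proof. by rewrite /= normr1. Qed.

Let measurable_cst1 : measurable_fun setT (cst 1 : Omega -> R).
Proof. exact: measurable_cst. Qed.

Lemma integrable_ip f : L2 f ->
  P.-integrable setT (EFin \o (fun w => ip (X w) f)).
Proof.
move=> L2f.
have ik := integrable_kern L2f measurable_cst1 norm_cst1.
apply: eq_integrable (integrable_Rintegral_l ik) => // w _ /=.
rewrite ip_mkcond; congr (_%:E); congr (Rintegral leb setT).
by apply/funext => t /=; rewrite mulr1.
Qed.

Section moments.
Variables (phi : Omega -> R) (M : R).
Hypotheses (mphi : measurable_fun setT phi) (bphi : forall w, `|phi w| <= M).
Let m t := Ex P (fun w => X w t * phi w).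

Let L2_one : L2 (cst 1 : R -> R).
Proof. by apply: (@L2_bounded _ 1) => // t _; rewrite normr1. Qed.

Lemma integrable_moment : leb.-integrable I01 (EFin \o m).
Proof.
apply/integrable_mkcond => //.
have ik := integrable_Rintegral_r (integrable_kern L2_one mphi bphi).
apply: eq_integrable ik => // t _ /=; rewrite /patch /=.
case: ifP => _; last first.
  rewrite (_ : (fun w => _) = cst 0) ?Rintegral_cst ?mul0r//.
  by apply/funext => w; rewrite mulr0.
by congr (_%:E); congr (Rintegral P setT); apply/funext => w; rewrite mulr1.
Qed.

Lemma measurable_moment : measurable_fun I01 m.
Proof. by have /integrableP[/measurable_EFinP] := integrable_moment. Qed.

Let ae_integrable_section :
  {ae leb, forall t, I01 t -> P.-integrable setT (EFin \o (fun w => X w t * phi w))}.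
Proof.
have := ae_integrable2 (integrable_kern L2_one mphi bphi).
apply: filterS => t; move=> ik It; apply: eq_integrable ik => // w _ /=.
by rewrite /patch mem_set// mulr1.
Qed.

Variable f : R -> R.
Hypothesis L2f : L2 f.

(** Pulling f(t) out of the expectation uses integrability of X(t) phi, available for almost every t
    in [0, 1]. *)
Let ae_kern : {ae leb, forall t, setT t ->
  \int[P]_w (X w t * phi w * (f \_ I01) t) = (m \_ I01) t * (f \_ I01) t}.
Proof.
apply: ae_lebS ae_integrable_section => t it _.
have [It|nIt] := pselect (I01 t).
  by rewrite RintegralZr//; [rewrite {2}/patch mem_set|exact: it].
rewrite /patch memNset// mulr0 (_ : (fun w => _) = cst 0) ?Rintegral_cst ?mul0r//.
by apply/funext => w; rewrite mulr0.
Qed.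

Let mf0 : measurable_fun setT (f \_ I01). Proof. exact: (L2_restrict L2f).1. Qed.

Let mm0 : measurable_fun setT (m \_ I01).
Proof.
by apply/measurable_restrict => //; rewrite setTI; exact: measurable_moment.
Qed.

Let integrable_kern_r := integrable_Rintegral_r (integrable_kern L2f mphi bphi).

(** By Fubini the expectation of the kernel at t is integrable in t, and it equals m(t) f(t) for
    almost every t in [0, 1]. *)
Lemma integrable_moment_mul :
  leb.-integrable I01 (EFin \o (fun t => m t * f t)).
Proof.
apply/integrable_mkcond => //.
have mmf : measurable_fun setT (fun t => (m \_ I01) t * (f \_ I01) t).
  exact: measurable_funM.
have E : ((EFin \o (fun t => m t * f t)) \_ I01) =
         EFin \o (fun t => (m \_ I01) t * (f \_ I01) t).
  by apply/funext => t; rewrite /patch /=; case: ifP => _ //=; rewrite mul0r.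
rewrite E; apply/integrableP; split; first exact/measurable_EFinP.
have /integrableP[mk] := integrable_kern_r; apply: le_lt_trans.
apply: ae_ge0_le_integral => //.
- by apply: measurableT_comp => //; exact/measurable_EFinP.
- exact: measurableT_comp.
- by apply: ae_lebS ae_kern => t /(_ Logic.I) /= -> _.
Qed.

(** Fubini for the kernel: f(t) leaves the inner expectation for almost every t, and phi(w) leaves
    the inner integral over [0, 1] for almost every w. *)
Lemma ip_moment : ip m f = Ex P (fun w => ip (X w) f * phi w).
Proof.
have ik := integrable_kern L2f mphi bphi.
transitivity (\int[leb]_t ((m \_ I01) t * (f \_ I01) t)).
  rewrite /ip Rintegral_mkcond; congr (Rintegral leb setT); apply/funext => t.
  by rewrite /patch; case: ifP => _ //; rewrite mul0r.
transitivity (\int[leb]_t \int[P]_w (X w t * phi w * (f \_ I01) t)).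
  apply: ae_eq_Rintegral => //.
  - exact: measurable_funM.
  - by have /integrableP[/measurable_EFinP] := integrable_kern_r.
  - by apply: ae_lebS ae_kern => t H _ /=; rewrite H.
rewrite -[LHS](Fubini_Rintegral ik) /Ex.
have mh : measurable_fun setT (fun w => ip (X w) f).
  exact/measurable_EFinP/(measurable_int _ (integrable_ip L2f)).
apply: ae_eq_Rintegral => //.
- exact/measurable_EFinP/(measurable_int _ (integrable_Rintegral_l ik)).
- exact: measurable_funM.
- apply: filterS (ae_integrable1 (integrable_kern L2f measurable_cst1 norm_cst1)).
  move=> w iw _ /=.
  rewrite ip_mkcond -RintegralZr//; last first.
    by apply: eq_integrable iw => // t _ /=; rewrite mulr1.
  by congr (Rintegral leb setT); apply/funext => t /=; ring.
Qed.

End moments.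

End second_order.

(** * Vanishing principal values *)

Section cubes.
Variables (R : realType) (q : nat).
Implicit Types s : q.-tuple R.

(** By contradiction: a counterexample in each cube of radius 1/(n + 1) gives a sequence converging
    to s. Continuity is taken along sequences because dominated convergence delivers it in that
    form. *)
Lemma cube_bound_of_cvg (G : q.-tuple R -> R) s (e : R) : 0 < e ->
  (forall s_ : nat -> q.-tuple R,
    (forall i, tnth (s_ n) i @[n --> \oo] --> tnth s i) ->
    G (s_ n) @[n --> \oo] --> G s) ->
  exists2 r : R, 0 < r & forall s', cube (tnth s) r s' -> `|G s - G s'| < e.
Proof.
move=> e0 cG; apply: contrapT => H.
have bad n : exists s', cube (tnth s) n.+1%:R^-1 s' /\ ~ (`|G s - G s'| < e).
  apply: contrapT => K; apply: H; exists n.+1%:R^-1; first by rewrite invr_gt0.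
  by move=> s' cs'; apply: contrapT => K'; apply: K; exists s'.
pose s_ n := sval (cid (bad n)).
have s_P n : cube (tnth s) n.+1%:R^-1 (s_ n) /\ ~ (`|G s - G (s_ n)| < e).
  exact: svalP (cid (bad n)).
have cs i : tnth (s_ n) i @[n --> \oo] --> tnth s i.
  apply/cvgrPdist_lt => a a0; near=> n.
  rewrite distrC; have [/forallP/(_ i) /le_lt_trans + _] := s_P n; apply.
  by near: n; exact: near_infty_natSinv_lt (PosNum a0).
have /cvgrPdist_lt/(_ e e0) [n _ /(_ n (leqnn n))] := cG s_ cs.
by have [_] := s_P n.
Unshelve. all: by end_near. Qed.

Lemma cvg_eucl_dot (s_ : nat -> q.-tuple R) s y :
  (forall i, tnth (s_ n) i @[n --> \oo] --> tnth s i) ->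
  eucl_dot (s_ n) y @[n --> \oo] --> eucl_dot s y.
Proof.
move=> cs; apply: cvg_big => [|i _]; first exact: add_continuous.
by apply: cvgM => //; exact: cvg_cst.
Qed.

Lemma cvg_eucl_norm (s_ : nat -> q.-tuple R) s :
  (forall i, tnth (s_ n) i @[n --> \oo] --> tnth s i) ->
  eucl_norm (s_ n) @[n --> \oo] --> eucl_norm s.
Proof.
move=> cs; apply: continuous_cvg; first exact: sqrt_continuous.
apply: cvg_big => [|i _]; first exact: add_continuous.
rewrite expr2.
by under eq_fun do rewrite expr2; exact: cvgM.
Qed.

Lemma ler_tnth_eucl_norm s i : `|tnth s i| <= eucl_norm s.
Proof.
rewrite -sqrtr_sqr; apply: ler_wsqrtr; rewrite (bigD1 i)//= lerDl.
by apply: sumr_ge0 => j _; exact: sqr_ge0.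
Qed.

Lemma eucl_norm_ge0 s : 0 <= eucl_norm s. Proof. exact: sqrtr_ge0. Qed.

Lemma eucl_norm0_dot s y : eucl_norm s = 0 -> eucl_dot s y = 0.
Proof.
move=> s0; apply: big1 => i _; have := ler_tnth_eucl_norm s i.
by rewrite s0 normr_le0 => /eqP ->; rewrite mul0r.
Qed.

Lemma Riter0 : Riter (fun _ : q.-tuple R => 0) = 0 :> R.
Proof.
elim: q => //= n IH; under eq_Rintegral do rewrite IH.
by rewrite Rintegral_cst// mul0r.
Qed.

End cubes.

(** * Nonnegative functions with zero weighted principal value *)

Section pv_zero.
Variables (R : realType) (q : nat) (F : q.-tuple R -> R) (M : R).
Hypotheses (F0 : forall s, 0 <= F s) (FM : forall s, F s <= M).

(** If F(s) > 0, then F >= F(s)/2 on a small cube around s that stays away from the origin, and for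
    small eps the truncated integral exceeds a positive constant free of eps. *)
Lemma pv_weighted_to0_eq0 s :
  (forall s_ : nat -> q.-tuple R,
    (forall i, tnth (s_ n) i @[n --> \oo] --> tnth s i) ->
    F (s_ n) @[n --> \oo] --> F s) ->
  0 < eucl_norm s -> pv_weighted_to F 0 -> F s = 0.
Proof.
move=> cF N0 pv0; set N := eucl_norm s in N0.
have q0 : (0 < q)%N.
  rewrite lt0n; apply/eqP => q0; move: N0; rewrite /N /eucl_norm big1 ?sqrtr0 ?ltxx//.
  by move=> i _; have := ltn_ord i; rewrite [X in (_ < X)%N]q0.
have cq0 := c_q_gt0 R q0.
have [Fs|//] := ltP 0 (F s); last by move=> Fs; apply/eqP; rewrite eq_le Fs F0.
have [|r1 r10 near1] := @cube_bound_of_cvg _ _ F s (F s / 2) _ cF.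
  by rewrite divr_gt0.
have [||r2 r20 near2] := @cube_bound_of_cvg _ _ (@eucl_norm R q) s (N / 2).
- by rewrite divr_gt0.
- by move=> s_; exact: cvg_eucl_norm.
pose r := Num.min r1 r2.
have r0 : 0 < r by rewrite lt_min r10.
have cube_le a s' : r <= a -> cube (tnth s) r s' -> cube (tnth s) a s'.
  by move=> ra /forallP cs; apply/forallP => i; exact: le_trans (cs i) ra.
have FB s' : cube (tnth s) r s' -> F s / 2 <= F s'.
  move=> cs; have := near1 _ (cube_le _ _ _ cs).
  by rewrite ge_min lexx => /(_ isT); rewrite ltr_norml => /andP[_]; lra.
have NB s' : cube (tnth s) r s' -> N / 2 <= eucl_norm s' <= 2 * N.
  move=> cs; have := near2 _ (cube_le _ _ _ cs).
  rewrite ge_min lexx orbT => /(_ isT); rewrite -/N ltr_norml => /andP[a b].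
  by clearbody N; apply/andP; split; lra.
pose k := (c_q q)^-1 * (2 * N) ^- q.+1 * (F s / 2).
have N20 : 0 < 2 * N by rewrite mulr_gt0.
have k0 : 0 < k by rewrite !mulr_gt0 ?invr_gt0 ?exprn_gt0.
suff : k * (2 * r) ^+ q <= 0.
  by rewrite leNgt mulr_gt0// exprn_gt0// mulr_gt0.
apply: (cvgr_to_ge pv0); near=> e.
have e0 : 0 < e by near: e; exact: nbhs_right_gt.
(* These thresholds on e put the whole cube, where norms lie in [N/2, 2N], inside the annulus. *)
have eN : e <= N / 2 by near: e; apply: nbhs_right_le; rewrite divr_gt0.
have eN' : e <= (2 * N)^-1 by near: e; apply: nbhs_right_le; rewrite invr_gt0.
have Ne : 2 * N <= e^-1 by rewrite -(invrK (2 * N)) lef_pV2// posrE invr_gt0.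
rewrite -(Riter_cube k (tnth s) (ltW r0)).
have eV0 : 0 <= e^-1 by rewrite invr_ge0 ltW.
have M0 : 0 <= M by exact: le_trans (F0 s) (FM s).
(* The annulus lies in the cube of radius 1/e about 0, and on it the weight is at most e^-(q+1) /
   c_q; with F <= M this is the required majorant. *)
apply: (@le_Riter _ _ _ _ ((c_q q)^-1 * e ^- q.+1 * M) e^-1 (fun=> 0)) => //.
- by move=> s'; rewrite mulr_ge0// ltW.
- move=> s'; have [cs|_] := boolP (cube _ _ _); last first.
    rewrite mulr0; case: ifP => _; rewrite ?mul0r// mul1r.
    by rewrite !mulr_ge0 ?invr_ge0 ?exprn_ge0 ?eucl_norm_ge0 ?F0 ?(ltW cq0).
  have /andP[N1 N2] := NB _ cs.
  have s'0 : 0 < eucl_norm s' by apply: lt_le_trans N1; rewrite divr_gt0.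
  rewrite (le_trans eN N1) (le_trans N2 Ne) mul1r mulr1.
  rewrite ler_pM ?FB ?mulr_ge0 ?invr_ge0 ?exprn_ge0 ?(ltW cq0) ?(ltW Fs) ?(ltW N20)//.
  rewrite ler_wpM2l ?invr_ge0 ?(ltW cq0)// lef_pV2 ?posrE ?exprn_gt0//.
  by rewrite lerXn2r// nnegrE ltW.
- move=> s'; case: ifP => [/andP[e1 e2]|_]; last first.
    by rewrite mul0r !mulr_ge0 ?invr_ge0 ?exprn_ge0 ?(ltW cq0) ?(ltW e0).
  have s'0 : 0 < eucl_norm s' by exact: lt_le_trans e1.
  have -> : cube (fun=> 0) e^-1 s'.
    apply/forallP => i; rewrite subr0; apply: le_trans e2.
    exact: ler_tnth_eucl_norm.
  rewrite mul1r mulr1 ler_pM ?mulr_ge0 ?invr_ge0 ?exprn_ge0 ?eucl_norm_ge0 ?(ltW cq0)//.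
  rewrite ler_wpM2l ?invr_ge0 ?(ltW cq0)// lef_pV2 ?posrE ?exprn_gt0//.
  by rewrite lerXn2r// nnegrE ltW.
Unshelve. all: by end_near. Qed.

End pv_zero.

(** * The martingale difference divergence operator *)

Section trig_moments.
Context d (Omega : measurableType d) (R : realType) (P : probability Omega R).
Notation leb := (@lebesgue_measure R).
Variables (q : nat) (Y : Omega -> q.-tuple R).
Hypothesis mY : measurable_fun setT Y.

Let cosY s w := cos (eucl_dot s (Y w)).
Let sinY s w := sin (eucl_dot s (Y w)).

Let mcosY s : measurable_fun setT (cosY s).
Proof. exact: (measurableT_comp (measurable_cos_dot s) mY). Qed.

Let msinY s : measurable_fun setT (sinY s).
Proof. exact: (measurableT_comp (measurable_sin_dot s) mY). Qed.

Let cosY1 s w : `|cosY s w| <= 1.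
Proof. by rewrite ler_norml cos_geN1 cos_le1. Qed.

Let sinY1 s w : `|sinY s w| <= 1.
Proof. by rewrite ler_norml sin_geN1 sin_le1. Qed.

Section one_element.
Variable X : Omega -> R -> R.
Hypothesis mX : random_element X.
Hypothesis X2 : (\int[P]_w \int[leb]_(t in I01) ((X w t) ^+ 2)%:E < +oo)%E.

(** With [phi] equal to cos<s,Y> or sin<s,Y> this computes the two parts of <G_s, f>. The mean of X
    is the moment with [phi] = 1, so both terms come from [ip_moment]. *)
Lemma ip_cov (f : R -> R) (phi : Omega -> R) (M : R) : L2 f ->
  measurable_fun setT phi -> (forall w, `|phi w| <= M) ->
  ip (fun t => Ex P (fun w => X w t * phi w) - Ex P (fun w => X w t) * Ex P phi) f =
  Ex P (fun w => ip (X w) f * phi w) - Ex P (fun w => ip (X w) f) * Ex P phi.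
Proof.
move=> L2f mphi bphi.
have m1 : measurable_fun setT (cst 1 : Omega -> R) by exact: measurable_cst.
have b1 (w : Omega) : `|cst 1 w : R| <= 1 by rewrite normr1.
have E1 t : Ex P (fun w => X w t) = Ex P (fun w => X w t * cst 1 w).
  by congr (Ex P _); apply/funext => w; rewrite mulr1.
have iE : Ex P (fun w => ip (X w) f) = ip (fun t => Ex P (fun w => X w t)) f.
  rewrite (funext E1) (ip_moment mX X2 m1 b1 L2f); congr (Ex P _).
  by apply/funext => w; rewrite mulr1.
have i1 : leb.-integrable I01 (EFin \o (fun t => Ex P (fun w => X w t) * f t)).
  have := integrable_moment_mul mX X2 m1 b1 L2f.
  by congr (integrable _ _ _); apply/funext => t /=; rewrite E1.
have iphi := integrable_moment_mul mX X2 mphi bphi L2f.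
rewrite iE -(ip_moment mX X2 mphi bphi L2f) mulrC /ip -RintegralZl//.
rewrite -RintegralB//.
- by apply: eq_Rintegral => t _; ring.
- exact: measurable_I01.
- by apply: (@integrableZl _ _ _ leb I01 _ (Ex P phi) _ i1); exact: measurable_I01.
- exact: measurable_I01.
Qed.

Lemma ip_Gre s (f : R -> R) : L2 f -> ip (Gre P X Y s) f =
  Ex P (fun w => ip (X w) f * cosY s w) - Ex P (fun w => ip (X w) f) * Ex P (cosY s).
Proof. by move=> L2f; exact: ip_cov L2f (mcosY s) (cosY1 s). Qed.

Lemma ip_Gim s (f : R -> R) : L2 f -> ip (Gim P X Y s) f =
  Ex P (fun w => ip (X w) f * sinY s w) - Ex P (fun w => ip (X w) f) * Ex P (sinY s).
Proof. by move=> L2f; exact: ip_cov L2f (msinY s) (sinY1 s). Qed.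

Lemma ip_moment_eq0 (f : R -> R) (phi : Omega -> R) (M : R) : L2 f ->
  measurable_fun setT phi -> (forall w, `|phi w| <= M) ->
  {ae leb, forall t, I01 t -> Ex P (fun w => X w t * phi w) = 0} ->
  Ex P (fun w => ip (X w) f * phi w) = 0.
Proof.
move=> L2f mphi bphi X0; rewrite -(ip_moment mX X2 mphi bphi L2f).
transitivity (\int[leb]_(t in I01) (0 : R)).
  apply: ae_eq_Rintegral => //.
  - exact: measurable_I01.
  - by have /integrableP[/measurable_EFinP] := integrable_moment_mul mX X2 mphi bphi L2f.
  - by apply: ae_lebS X0 => t X0 It; rewrite X0// mul0r.
by rewrite Rintegral_cst ?mul0r//; exact: measurable_I01.
Qed.

Hypothesis X0 : mean_zero P X.

Lemma Ex_ip_eq0 (f : R -> R) : L2 f -> Ex P (fun w => ip (X w) f) = 0.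
Proof.
move=> L2f; rewrite -(@ip_moment_eq0 f (cst 1) 1)//.
- by congr (Ex P _); apply/funext => w; rewrite mulr1.
- by move=> w; rewrite normr1.
- apply: ae_lebS X0 => t X0t It; rewrite -(X0t It); congr (Ex P _).
  by apply/funext => w; rewrite mulr1.
Qed.

Lemma MDDO_zero_ip_eq0 (f : R -> R) s : L2 f -> MDDO_zero P X Y ->
  Ex P (fun w => ip (X w) f * cosY s w) = 0 /\
  Ex P (fun w => ip (X w) f * sinY s w) = 0.
Proof.
move=> L2f /(_ f f L2f L2f)[pv0 _].
have ih := integrable_ip mX X2 L2f; set h := fun w => ip (X w) f in ih *.
have Eh0 : Ex P h = 0 by exact: Ex_ip_eq0.
pose u s := Ex P (fun w => h w * cosY s w).
pose v s := Ex P (fun w => h w * sinY s w).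
rewrite -/(u s) -/(v s).
(* Centering cancels the products of means, and f = g makes the real part a sum of two squares. *)
have FE : rank1_re P X Y f f = fun s => u s ^+ 2 + v s ^+ 2.
  apply/funext => s'; rewrite /rank1_re ip_Gre// ip_Gim// -/h Eh0 !mul0r !subr0.
  by rewrite !expr2.
have bound (phi : Omega -> R) : measurable_fun setT phi ->
    (forall w, `|phi w| <= 1) -> (Ex P (fun w => h w * phi w)) ^+ 2 <=
    (Ex P (fun w => `|h w|)) ^+ 2.
  move=> mphi bphi; have ihp := integrable_mul_bounded ih mphi bphi.
  rewrite -(real_normK (num_real (Ex P (fun w => h w * phi w)))).
  rewrite lerXn2r ?nnegrE//; first by apply: Rintegral_ge0.
  apply: le_trans (le_normr_Rintegral _ ihp) _ => //.
  apply: le_Rintegral => //; [exact: (integrable_norm ihp)|exact: (integrable_norm ih)|].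
  by move=> w _ /=; rewrite normrM -[leRHS]mulr1 ler_wpM2l.
(* The principal value argument excludes the origin; there the cosine is 1, leaving the mean of h,
   and the sine is 0. *)
have [s0|sn0] := eqVneq (eucl_norm s) 0.
  split.
    rewrite -[RHS]Eh0; congr (Ex P _); apply/funext => w.
    by rewrite /cosY eucl_norm0_dot// cos0 mulr1.
  rewrite /v (_ : (fun w => _) = cst 0); first by rewrite /Ex Rintegral_cst ?mul0r.
  by apply/funext => w; rewrite /sinY eucl_norm0_dot// sin0 mulr0.
have : rank1_re P X Y f f s = 0.
  apply: (@pv_weighted_to0_eq0 _ _ _ ((Ex P (fun w => `|h w|)) ^+ 2 *+ 2)) pv0.
  - by move=> s'; rewrite FE addr_ge0 ?sqr_ge0.
  - by move=> s'; rewrite FE mulr2n lerD// bound.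
  - move=> s_ cs; rewrite FE.
    have cu : u (s_ n) @[n --> \oo] --> u s.
      apply: (@cvg_Rintegral_mul _ _ _ P h (fun n => cosY (s_ n)) _ 1 ih _ _ _).2 => //.
      move=> w; apply: continuous_cvg; first exact: continuous_cos.
      exact: cvg_eucl_dot.
    have cv : v (s_ n) @[n --> \oo] --> v s.
      apply: (@cvg_Rintegral_mul _ _ _ P h (fun n => sinY (s_ n)) _ 1 ih _ _ _).2 => //.
      move=> w; apply: continuous_cvg; first exact: continuous_sin.
      exact: cvg_eucl_dot.
    by apply: cvgD; rewrite expr2; under eq_fun do rewrite expr2; exact: cvgM.
  - by rewrite lt_neqAle eq_sym sn0 eucl_norm_ge0.
rewrite FE => /eqP; rewrite paddr_eq0 ?sqr_ge0// !sqrf_eq0.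
by move=> /andP[/eqP -> /eqP ->].
Qed.

Let indicY (B : set (q.-tuple R)) (w : Omega) : R := \1_B (Y w).

Let mindicY B : measurable B -> measurable_fun setT (indicY B).
Proof. by move=> mB; apply: (measurableT_comp _ mY); exact: measurable_indic. Qed.

Let indicY1 B w : `|indicY B w| <= 1.
Proof. by rewrite /indicY indicE ger0_norm ?ler0n// lern1 leq_b1. Qed.

Let Ex_indicY B t :
  Ex P (fun w => X w t * indicY B w) = \int[P]_(w in Y @^-1` B) X w t.
Proof.
rewrite /Ex [RHS]Rintegral_mkcond; congr (Rintegral P setT).
apply/funext => w; rewrite /indicY indicE /patch.
rewrite (_ : (Y w \in B) = (w \in Y @^-1` B)); last by apply/idP/idP; rewrite !inE.
by case: ifP => _; rewrite ?mulr1 ?mulr0.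
Qed.

Lemma MDDO_zero_cond_exp_zero : MDDO_zero P X Y <-> cond_exp_zero P X Y.
Proof.
split=> [MDDO0 B mB|ce0 f g L2f L2g].
- pose m t := Ex P (fun w => X w t * indicY B w).
  have im : leb.-integrable I01 (EFin \o m).
    exact: (integrable_moment mX X2 (mindicY mB) (indicY1 B)).
  (* It suffices that [m] has zero integral over every measurable E inside [0, 1]; each such
     integral is the pairing of [m] with the indicator of E. *)
  have : ae_eq leb I01 (EFin \o m) (cst 0%E).
    apply: integral_ae_eq => //; first exact: measurable_I01.
    move=> E EI mE; rewrite integral0.
    have L2E : L2 (\1_E : R -> R).
      apply: (@L2_bounded _ _ 1) => [|t _]; first exact: measurable_indic.
      by rewrite indicE ger0_norm ?ler0n// lern1 leq_b1.
    have imE : leb.-integrable E (EFin \o m).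
      by apply: integrableS im => //; exact: measurable_I01.
    rewrite -[LHS]fineK; last exact: integrable_fin_num.
    congr (_%:E); transitivity (ip m \1_E).
      rewrite /ip [RHS]Rintegral_mkcond -/(Rintegral leb E m) Rintegral_mkcond.
      congr (Rintegral leb setT); apply/funext => t; rewrite /patch indicE.
      case: ifPn => tE; case: ifPn => tI; rewrite ?mulr1 ?mulr0//.
      by move: tI; rewrite notin_setE => /(_ (EI _ (set_mem tE))).
    rewrite (ip_moment mX X2 (mindicY mB) (indicY1 B) L2E).
    have ih := integrable_ip mX X2 L2E.
    have [_ _] := annihilated_indic ih mY
      (fun s => (MDDO_zero_ip_eq0 s L2E MDDO0).1)
      (fun s => (MDDO_zero_ip_eq0 s L2E MDDO0).2) mB.
    exact.
  by apply: ae_lebS => t + It => /(_ It)[]; rewrite /m Ex_indicY.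
(* Conversely, orthogonality to the indicators 1_B(Y) extends to sines and cosines of <s,Y>, so
   every pairing with G_s is 0. *)
- have ip0 f' s : L2 f' -> ip (Gre P X Y s) f' = 0 /\ ip (Gim P X Y s) f' = 0.
    move=> L2f'; rewrite ip_Gre// ip_Gim// Ex_ip_eq0// !mul0r !subr0.
    have ih := integrable_ip mX X2 L2f'.
    have h0 B : measurable B -> Ex P (fun w => ip (X w) f' * indicY B w) = 0.
      move=> mB; apply: (ip_moment_eq0 L2f' (mindicY mB) (indicY1 B)).
      by apply: ae_lebS (ce0 B mB) => t H It; rewrite Ex_indicY H.
    split.
      have [|_ _] := annihilated_bounded ih mY h0 (measurable_cos_dot s) (M := 1); last exact.
      by move=> y; rewrite ler_norml cos_geN1 cos_le1.
    have [|_ _] := annihilated_bounded ih mY h0 (measurable_sin_dot s) (M := 1); last exact.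
    by move=> y; rewrite ler_norml sin_geN1 sin_le1.
  (* An identically zero integrand makes every truncated integral 0, so the limit is that of a
     constant. *)
  have pv0 (F : q.-tuple R -> R) : (forall s, F s = 0) -> pv_weighted_to F 0.
    move=> F0; rewrite /pv_weighted_to (_ : (fun eps : R => _) = cst 0).
      exact: cvg_cst.
    apply/funext => eps /=; rewrite -[RHS](Riter0 R q); congr Riter.
    by apply/funext => s; rewrite F0 !mulr0.
  split; apply: pv0 => s; rewrite /rank1_re /rank1_im.
    by rewrite (ip0 f s L2f).1 (ip0 f s L2f).2 !mul0r addr0.
  by rewrite (ip0 f s L2f).1 (ip0 f s L2f).2 !mul0r subr0.
Qed.

End one_element.
End trig_moments.

(** * Transformation under a bounded operator and its adjoint *)

Section operators.
Context d (Omega : measurableType d) (R : realType) (P : probability Omega R).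
Notation leb := (@lebesgue_measure R).
Variables (X Z : Omega -> R -> R) (T Ts : (R -> R) -> (R -> R)).
Hypothesis mX : random_element X.
Hypothesis X2 : (\int[P]_w \int[leb]_(t in I01) ((X w t) ^+ 2)%:E < +oo)%E.
Hypotheses (bT : bounded_linear_op T) (aT : is_adjoint T Ts).
Hypotheses (mZ : random_element Z) (ZX : forall w, Heq (Z w) (Ts (X w))).

Let L2_Ts w : L2 (X w) -> L2 (Ts (X w)).
Proof. by move=> L2X; have [[L2Ts _ _ _] _] := aT; exact: L2Ts. Qed.

Let sqnormE (f : R -> R) : L2 f ->
  (\int[leb]_(t in I01) ((f t) ^+ 2)%:E = (ip f f)%:E)%E.
Proof.
move=> [_ f2]; rewrite -[LHS]fineK; last first.
  by rewrite ge0_fin_numE//; apply: integral_ge0 => t _; rewrite lee_fin sqr_ge0.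
by congr (fine _)%:E; apply: eq_integral => t _; rewrite expr2.
Qed.

(** The operator bound gives ||T^* X||^2 <= C ||X||^2 wherever X(w) is in L^2; |C| replaces C, whose
    sign is unspecified. *)
Lemma adjoint_sqnorm_lty :
  (\int[P]_w \int[leb]_(t in I01) ((Z w t) ^+ 2)%:E < +oo)%E.
Proof.
have [[_ _ _ [C TsC]] _] := aT.
have g0 (V : Omega -> R -> R) w :
    (0 <= \int[leb]_(t in I01) ((V w t) ^+ 2)%:E)%E.
  by apply: integral_ge0 => t _; rewrite lee_fin sqr_ge0.
apply: (@le_lt_trans _ _
    (\int[P]_w (`|C|%:E * \int[leb]_(t in I01) ((X w t) ^+ 2)%:E))%E).
  apply: ae_ge0_le_integral => //.
  - exact: measurable_sqnorm.
  - by move=> w _; rewrite mule_ge0.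
  - by apply: measurable_funeM; exact: measurable_sqnorm.
  apply: filterS (ae_L2_section mX X2) => w L2X _.
  rewrite (_ : (\int[leb]_(t in I01) ((Z w t) ^+ 2)%:E)%E =
               (\int[leb]_(t in I01) ((Ts (X w) t) ^+ 2)%:E)%E).
    rewrite !sqnormE//; last exact: L2_Ts.
    rewrite -EFinM lee_fin; apply: le_trans (TsC _ L2X) _.
    apply: ler_wpM2r; last exact: ler_norm.
    by apply: Rintegral_ge0 => t _; rewrite -expr2 sqr_ge0.
  apply: ae_eq_integral.
  - exact: measurable_I01.
  - by apply/measurable_EFinP; apply: measurable_funX; exact: measurable_section.
  - by apply/measurable_EFinP; apply: measurable_funX; exact: (L2_Ts L2X).1.
  - by apply: ae_lebS (ZX w) => t ZXt It /=; rewrite ZXt.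
rewrite ge0_integralZl//; last exact: measurable_sqnorm.
by apply: lte_mul_pinfty; rewrite ?lee_fin.
Qed.

(** The adjoint identity <T^* X, f> = <X, T f> holds wherever X(w) is in L^2, hence almost surely;
    [Z] may differ from T^* X on a null set of t, which the inner product ignores. *)
Lemma Ex_ip_adjoint (f : R -> R) (phi : Omega -> R) : L2 f ->
  measurable_fun setT phi ->
  Ex P (fun w => ip (Z w) f * phi w) = Ex P (fun w => ip (X w) (T f) * phi w).
Proof.
move=> L2f mphi; have L2Tf : L2 (T f) by have [L2T _ _ _] := bT; exact: L2T.
have mip (V : Omega -> R -> R) g : P.-integrable setT (EFin \o (fun w => ip (V w) g)) ->
    measurable_fun setT (fun w => ip (V w) g * phi w).
  by move=> /integrableP[/measurable_EFinP mV _]; exact: measurable_funM.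
apply: ae_eq_Rintegral => //.
- exact: mip (integrable_ip mZ adjoint_sqnorm_lty L2f).
- exact: mip (integrable_ip mX X2 L2Tf).
apply: filterS (ae_L2_section mX X2) => w L2X _; congr (_ * _).
have [_ <-//] := aT.
apply: ae_eq_Rintegral.
- exact: measurable_I01.
- by apply: measurable_funM; [exact: measurable_section|exact: L2f.1].
- by apply: measurable_funM; [exact: (L2_Ts L2X).1|exact: L2f.1].
- by apply: ae_lebS (ZX w) => t ZXt It /=; rewrite ZXt.
Qed.

(** The integrands agree for every s, so the principal values coincide without any passage to the
    limit. *)
Lemma rank1_adjoint q (Y : Omega -> q.-tuple R) (f g : R -> R) :
  measurable_fun setT Y -> L2 f -> L2 g ->
  rank1_re P Z Y f g = rank1_re P X Y (T f) (T g) /\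
  rank1_im P Z Y f g = rank1_im P X Y (T f) (T g).
Proof.
move=> mY L2f L2g.
have L2T f' : L2 f' -> L2 (T f') by have [L2T _ _ _] := bT; exact: L2T.
have Z2 := adjoint_sqnorm_lty.
have E1 f' : L2 f' -> Ex P (fun w => ip (Z w) f') = Ex P (fun w => ip (X w) (T f')).
  move=> L2f'; have := @Ex_ip_adjoint f' (cst 1) L2f' (measurable_cst _).
  by congr (Ex P _ = Ex P _); apply/funext => w; rewrite /= mulr1.
have re s f' : L2 f' -> ip (Gre P Z Y s) f' = ip (Gre P X Y s) (T f').
  move=> L2f'; rewrite !ip_Gre ?E1//; last exact: L2T.
  rewrite Ex_ip_adjoint//.
  exact: (measurableT_comp (measurable_cos_dot s) mY).
have im s f' : L2 f' -> ip (Gim P Z Y s) f' = ip (Gim P X Y s) (T f').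
  move=> L2f'; rewrite !ip_Gim ?E1//; last exact: L2T.
  rewrite Ex_ip_adjoint//.
  exact: (measurableT_comp (measurable_sin_dot s) mY).
by split; apply/funext => s; rewrite /rank1_re /rank1_im !re// !im.
Qed.

End operators.

Unset Implicit Arguments.

(** The operator identity of (ii) is read through <T^* MDDO T f, g> = <MDDO T f, T g>, with [Z] a
    jointly measurable version of T^* X. The equivalence for all [lr], [li] says that the principal
    values on both sides exist together and agree. *)
Theorem theorem2p1 (R : realType) (d : measure_display)
  (Omega : measurableType d) (P : probability Omega R) (q : nat)
  (X : Omega -> R -> R) (Y : Omega -> q.-tuple R) :
  random_element X ->
  measurable_fun [set: Omega] Y ->
  mean_zero P X ->
  (\int[P]_w ((\int[@lebesgue_measure R]_(t in I01) ((X w t) ^+ 2)%:E)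
              + ((eucl_norm (Y w)) ^+ 2)%:E) < +oo)%E ->
  (MDDO_zero P X Y <-> cond_exp_zero P X Y) /\
  (forall T Ts : (R -> R) -> (R -> R),
     bounded_linear_op T -> is_adjoint T Ts ->
     forall Z : Omega -> R -> R,
       random_element Z -> (forall w, Heq (Z w) (Ts (X w))) ->
       forall f g, L2 f -> L2 g -> forall lr li : R,
         MDDO_form_to P Z Y f g lr li <->
         MDDO_form_to P X Y (T f) (T g) lr li).
Proof.
move=> mX mY X0 XY2.
have X2 : (\int[P]_w \int[@lebesgue_measure R]_(t in I01) ((X w t) ^+ 2)%:E < +oo)%E.
  have nX w : (0 <= \int[@lebesgue_measure R]_(t in I01) ((X w t) ^+ 2)%:E)%E.
    by apply: integral_ge0 => t _; rewrite lee_fin sqr_ge0.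
  apply: le_lt_trans XY2; apply: ge0_le_integral_nomeas => w _ //.
  by rewrite leeDl// lee_fin sqr_ge0.
split; first exact: MDDO_zero_cond_exp_zero.
move=> T Ts bT aT Z mZ ZX f g L2f L2g lr li.
have [re im] := rank1_adjoint mX X2 bT aT mZ ZX mY L2f L2g.
by rewrite /MDDO_form_to re im.
Qed.
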